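(* Let $N$ be an oriented $3$-manifold, $F$ an oriented surface, and $\pi:N\to F$ an $S^1$-fibration. Let $K'$ be an oriented singular knot in $N$ whose only singularity is a point of transverse self-intersection, projecting to a double point $v$ of $\pi(K')$ (with $\pi(K')$ generic), and let $\xi_1,\xi_2\in H_1(N)$ be the homology classes of the two loops of $K'$ adjacent to this point. Let $K_+$ and $K_-$ be the positive and negative resolutions of the singular point obtained by moving the two branches slightly apart along the fiber $\pi^{-1}(v)$. Then $$S_{K_+}-S_{K_-}=(f-e)(\xi_1+\xi_2)$$ in $H$. Consequently $S_K$ is a Vassiliev invariant of order one: its second derivative (the alternating sum of its values over the four resolutions of a singular knot with two transverse double points) is $0$.
   Context: A knot $K\subset N$ is generic with respect to $\pi$ if $\pi|_K$ is an immersion with only transversal double points as self-intersections. The operation in $H_1(N)$ is written multiplicatively; $e$ is the zero class, $[K]$ the class of $K$. The orientations of $N$ and $F$ orient the fibers (so that orientation of $N$ = orientation of base followed by orientation of fiber); $f$ is the class of a positively oriented fiber. A resolution is positive if (tangent vector of the upper branch, tangent vector of the lower branch) projects to a positive frame of $F$, where the upper branch is the one displaced in the positive fiber direction; otherwise it is negative. For a generic oriented knot $K$, $H$ is the quotient of the $\mathbb{Z}$-module $\mathbb{Z}[H_1(N)]$ by the submodule generated by $[K]-f$ and $[K]f-e$ (note $[K_+]=[K_-]=\xi_1\xi_2$), and $$S_K=\sum_v([\mu^+_v]-[\mu^-_v])\in H,$$ summed over double points $v$ of $\pi(K)$. Here $\pi^{-1}(v)$ divides $K$ into two oriented arcs;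 complete each to an oriented closed curve by adding the arc of $\pi^{-1}(v)$ which, with the positive fiber orientation, runs from the end point of the arc of $K$ to its starting point. Identify (preserving orientation) a neighborhood of $v$ in $F$ with a plane in which both branches of $\pi(K)$ are directed upwards; after oriented smoothing at $v$, $\mu^+_v$ is the curve whose projection near $v$ lies to the left and $\mu^-_v$ the one lying to the right. *)

(* Defs.v *)
From HB Require Import structures.
From mathcomp Require Import all_boot all_order all_algebra.
From mathcomp Require Import generic_quotient ring_quotient.
From mathcomp Require Import all_classical all_reals.
From mathcomp Require Import topology normedtype derive.
From mathcomp Require Import freeg.

Set Implicit Arguments.
Unset Strict Implicit.
Unset Printing Implicit Defensive.
Import Order.TTheory GRing.Theory Num.Theory.
Import numFieldNormedType.Exports.
Import Quotient.

Local Open Scope quotient_scope.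
Local Open Scope classical_set_scope.
Local Open Scope ring_scope.

Section Smooth.
Context {R : realType}.

Fixpoint Ck (k : nat) (V W : normedModType R) (U : set V) (f : V -> W) : Prop :=
  if k is k'.+1 then
    (forall x, U x -> differentiable f x) /\
    (forall v, Ck k' U (fun x => 'D_v f x))
  else forall x, U x -> {for x, continuous f}.

Definition smooth_at (V W : normedModType R) (f : V -> W) (x : V) : Prop :=
  exists U : set V, [/\ open U, U x & forall k, Ck k U f].

(* [chart_inv] is only meaningful on the image of [chart_dom]. *)
Record chart (n : nat) (M : topologicalType) := Chart {
  chart_dom : set M;
  chart_map :> M -> 'rV[R]_n;
  chart_inv : 'rV[R]_n -> M }.

Definition is_chart n (M : topologicalType) (c : chart n M) : Prop :=
  [/\ open (chart_dom c),
      open (c @` chart_dom c),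
      {within chart_dom c, continuous c},
      {within c @` chart_dom c, continuous (chart_inv c)} &
      forall x, chart_dom c x -> chart_inv c (c x) = x].

End Smooth.

(* An n-manifold without boundary; the orientation is the choice of an atlas
   whose changes of coordinates have positive Jacobian determinant. *)
Record oriented_manifold (R : realType) (n : nat) := OrientedManifold {
  space :> topologicalType;
  atlas : set (@chart R n space);
  space_hausdorff : hausdorff_space space;
  space_second_countable : @second_countable space;
  atlas_chart : forall c, atlas c -> is_chart c;
  atlas_cover : forall x, exists2 c, atlas c & chart_dom c x;
  atlas_transition : forall c d x, atlas c -> atlas d ->
    chart_dom c x -> chart_dom d x ->
    smooth_at (d \o chart_inv c) (c x) /\
    0 < \det ('J (d \o chart_inv c) (c x)) }.

Section Maps.
Context {R : realType}.

Definition smooth_map m n (M : oriented_manifold R m)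
    (M' : oriented_manifold R n) (f : M -> M') : Prop :=
  continuous f /\
  forall c d x, atlas c -> atlas d -> chart_dom c x -> chart_dom d (f x) ->
    smooth_at (d \o f \o chart_inv c) (c x).

Context {n : nat} {M : oriented_manifold R n}.
Implicit Types (eta : R -> M) (s t : R) (c : @chart R n M).

Definition smooth_curve eta : Prop :=
  continuous eta /\
  forall c t, atlas c -> chart_dom c (eta t) ->
    smooth_at (c \o eta : R^o -> 'rV[R]_n) t.

Definition same_mod1 s t : Prop := s - t \is a Num.int.

(* The tangent vector of [eta] at time [t], read in the chart [c]. *)
Definition velocity c eta t : 'rV[R]_n := derive1 (c \o eta : R -> 'rV[R]_n) t.

(* Smooth immersions of the oriented circle R/Z. *)
Definition immersed_loop eta : Prop :=
  [/\ smooth_curve eta,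
      forall t, eta (t + 1) = eta t &
      forall c t, atlas c -> chart_dom c (eta t) -> velocity c eta t != 0].

(* To be used when eta s = eta t. *)
Definition transverse_at eta s t : Prop :=
  forall c, atlas c -> chart_dom c (eta s) ->
    row_free (col_mx (velocity c eta s) (velocity c eta t)).

End Maps.

(* (tangent at s, tangent at t) is a positive frame of the oriented surface;
   to be used when eta s = eta t. *)
Definition positive_frame (R : realType) (F : oriented_manifold R 2)
    (eta : R -> F) (s t : R) : Prop :=
  exists c, [/\ atlas c, chart_dom c (eta s) &
    0 < \det (col_mx (velocity c eta s) (velocity c eta t) : 'M[R]_2)].

(* An immersion whose only self-intersections are transverse double points. *)
Definition generic_loop (R : realType) (F : oriented_manifold R 2)
    (eta : R -> F) : Prop :=
  [/\ immersed_loop eta,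
      forall s t, ~ same_mod1 s t -> eta s = eta t -> transverse_at eta s t &
      forall s t u, eta s = eta t -> eta t = eta u ->
        [\/ same_mod1 s t, same_mod1 t u | same_mod1 s u]].

Section Fibration.
Context {R : realType} {N : oriented_manifold R 3} {F : oriented_manifold R 2}.

(* [triv_map] plays the role of a map U x R/Z -> N over the open set U of F,
   and [triv_angle] is a (not necessarily continuous) choice of the second
   component of its inverse. *)
Record trivialization := Trivialization {
  triv_base : set F;
  triv_map : F -> R -> N;
  triv_angle : N -> R }.

(* [triv_map] in local coordinates, the base coordinates coming first. *)
Definition triv_coord (tau : trivialization) (c : @chart R 2 F)
    (d : @chart R 3 N) : 'rV[R]_3 -> 'rV[R]_3 :=
  fun w : 'rV[R]_(2 + 1) =>
    d (triv_map tau (chart_inv c (lsubmx w)) (rsubmx w 0 0)).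

Definition triv_pt (c : @chart R 2 F) (x : F) (t : R) : 'rV[R]_3 :=
  row_mx (c x) (t%:M : 'M[R]_1).

(* A diffeomorphism from U x R/Z onto the preimage of U, over U: a bijection
   which is smooth with everywhere invertible differential. *)
Definition is_trivialization (pi : N -> F) (tau : trivialization) : Prop :=
  [/\ open (triv_base tau),
      forall x t, triv_base tau x ->
        triv_map tau x (t + 1) = triv_map tau x t /\ pi (triv_map tau x t) = x,
      (forall p, triv_base tau (pi p) ->
        triv_map tau (pi p) (triv_angle tau p) = p) /\
      (forall x s t, triv_base tau x ->
        triv_map tau x s = triv_map tau x t -> same_mod1 s t),
      forall x t, triv_base tau x ->
        {for (x, t), continuous (fun q : F * R => triv_map tau q.1 q.2)} &
      forall c d x t, atlas c -> atlas d -> triv_base tau x ->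
        chart_dom c x -> chart_dom d (triv_map tau x t) ->
        smooth_at (triv_coord tau c d) (triv_pt c x t) /\
        \det ('J (triv_coord tau c d) (triv_pt c x t)) != 0].

End Fibration.
Arguments trivialization {R} N F.

Record circle_fibration (R : realType) (N : oriented_manifold R 3)
    (F : oriented_manifold R 2) := CircleFibration {
  proj :> N -> F;
  proj_smooth : smooth_map proj;
  locally_trivial : forall x, exists tau : trivialization N F,
    is_trivialization proj tau /\ triv_base tau x }.

Section Fibers.
Context {R : realType} {N : oriented_manifold R 3} {F : oriented_manifold R 2}.
Variable pi : circle_fibration N F.

Definition triv_at (x : F) : trivialization N F :=
  projT1 (cid (locally_trivial pi x)).

Lemma triv_atP x : is_trivialization pi (triv_at x) /\ triv_base (triv_at x) x.
Proof. by rewrite /triv_at; case: cid. Qed.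

(* 1 or -1 according to whether [triv_at x], for the orientation of the base
   followed by the standard one of R/Z, preserves or reverses orientations
   along the fiber of x. *)
Definition fiber_sign (x : F) : R :=
  if `[< exists c d, [/\ atlas c, atlas d, chart_dom c x,
           chart_dom d (triv_map (triv_at x) x 0) &
           0 < \det ('J (triv_coord (triv_at x) c d) (triv_pt c x 0))] >]
  then 1 else -1.

(* A 1-periodic parametrization of the positively oriented fiber of x. *)
Definition fiber (x : F) (t : R) : N :=
  triv_map (triv_at x) x (fiber_sign x * t).

(* fiber (pi p) (fiber_angle p) = p *)
Definition fiber_angle (p : N) : R :=
  fiber_sign (pi p) * triv_angle (triv_at (pi p)) p.

Lemma fiber_continuous x : continuous (fiber x).
Proof.
move=> t; have [[_ _ _ ctau _] bx] := triv_atP x.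
have cx := ctau x (fiber_sign x * t) bx.
have cs : (fiber_sign x * u)%R @[u --> t] --> (fiber_sign x * t)%R.
  by apply: cvgM; [exact: cvg_cst | exact: cvg_id].
exact: (@continuous_comp R (F * R)%type N (fun u => (x, fiber_sign x * u)%R) _ t
  (cvg_pair (cvg_cst x) cs) cx).
Qed.

HB.instance Definition _ x := isContinuous.Build R N (fiber x)
  (@fiber_continuous x).

End Fibers.

(* The representative of b modulo 1 in the interval [a, a + 1[. *)
Definition next_after (R : realType) (a b : R) : R :=
  b - (Num.floor (b - a))%:~R.

Section Homology.
Context {R : realType}.

Definition Delta (n : nat) : set 'rV[R]_n.+1 :=
  [set x | (forall i, 0 <= x 0 i) /\ \sum_i x 0 i = 1].
Arguments Delta : clear implicits.

Definition face_row n (i : 'I_n.+2) (x : 'rV[R]_n.+1) : 'rV[R]_n.+2 :=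
  \row_j (if unlift i j is Some k then x 0 k else 0).

Lemma face_row_Delta n (i : 'I_n.+2) (x : Delta n) :
  face_row i (val x) \in Delta n.+1.
Proof.
case: x => x /= /set_mem[x0 x1]; apply/mem_set; split=> [j|].
  by rewrite mxE; case: unlift.
rewrite (bigD1_ord i) //= mxE unlift_none add0r -[RHS]x1.
by apply: eq_bigr => k _; rewrite mxE liftK.
Qed.

Definition face n (i : 'I_n.+2) (x : Delta n) : Delta n.+1 :=
  exist _ (face_row i (val x)) (face_row_Delta i x).

Lemma bary_continuous n k : continuous (fun x : Delta n => val x 0 k).
Proof.
move=> x; exact: (@continuous_comp _ _ _ (val : Delta n -> 'rV[R]_n.+1) _ x
  (@initial_continuous _ _ _ x) (@coord_continuous _ _ _ 0 k (val x))).
Qed.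

Lemma face_continuous n (i : 'I_n.+2) : continuous (@face n i).
Proof.
apply: continuous_comp_initial => x A [P Px PA].
have Pj j : nbhs x [set y : Delta n | P 0 j (face_row i (val y) 0 j)].
  have := Px 0 j; rewrite /= mxE; case E: (unlift i j) => [k|] Pk.
    have -> : [set y : Delta n | P 0 j (face_row i (val y) 0 j)] =
        (fun y : Delta n => val y 0 k) @^-1` P 0 j.
      by apply/funext => y; rewrite /= mxE E.
    exact: (@bary_continuous n k x).
  suff -> : [set y : Delta n | P 0 j (face_row i (val y) 0 j)] = setT.
    exact: filterT.
  apply/funext => y; rewrite /= mxE E; apply/propext; split => // _.
  exact: nbhs_singleton Pk.
have Pn : nbhs x (fun y : Delta n => forall j, P 0 j (face_row i (val y) 0 j)).
  exact: filter_forall Pj.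
by apply: filterS Pn => y Py; apply: PA => a j; rewrite ord1; exact: Py.
Qed.

HB.instance Definition _ n i := isContinuous.Build (Delta n) (Delta n.+1)
  (@face n i) (@face_continuous n i).

(* In barycentric coordinates, the affine map of the 1-simplex onto [a, b]. *)
Definition segment (a b : R) (x : Delta 1) : R :=
  val x 0 0 * a + val x 0 1 * b.

Lemma segment_continuous a b : continuous (segment a b).
Proof.
have scale k c : continuous (fun x : Delta 1 => val x 0 k * c).
  move=> x; exact: (@continuous_comp _ _ _ (fun y : Delta 1 => val y 0 k)
    (fun u => u * c) x (@bary_continuous 1 k x) (@mulrr_continuous _ c _)).
move=> x; exact: continuousD (scale 0 a x) (scale 1 b x).
Qed.

HB.instance Definition _ a b := isContinuous.Build (Delta 1) R
  (segment a b) (@segment_continuous a b).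

Variable X : topologicalType.

Definition simplex (n : nat) := continuousType (Delta n) X.

Definition chain (n : nat) := {freeg (simplex n) / int}.

Definition bdry n : chain n.+1 -> chain n :=
  fglift (fun s : simplex n.+1 =>
    \sum_(i < n.+2) << (-1) ^+ i *g (s \o @face n i : simplex n) >>).

Lemma bdryB n : zmod_morphism (@bdry n).
Proof. exact: lift_is_additive. Qed.

Definition is_cycle (c : chain 1) : bool := bdry c == 0.

HB.instance Definition _ n := GRing.isZmodMorphism.Build (chain n.+1) (chain n)
  (@bdry n) (@bdryB n).

Lemma is_cycle_zmod_closed : zmod_closed is_cycle.
Proof.
split=> [|c d]; rewrite !unfold_in /is_cycle ?raddf0 // raddfB /=.
by move=> /eqP-> /eqP->; rewrite subrr.
Qed.

HB.instance Definition _ := GRing.isZmodClosed.Build (chain 1) is_cycle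
  is_cycle_zmod_closed.

Definition cycle1 := {c : chain 1 | is_cycle c}.
HB.instance Definition _ := Choice.on cycle1.
HB.instance Definition _ := SubType.on cycle1.
HB.instance Definition _ := [SubChoice_isSubZmodule of cycle1 by <:].

Definition is_bdry (z : cycle1) : bool :=
  `[< exists w : chain 2, bdry w = val z >].

Lemma is_bdry_zmod_closed : zmod_closed is_bdry.
Proof.
split=> [|c d]; first by apply/asboolP; exists 0; rewrite !raddf0.
move=> /asboolP[u uc] /asboolP[v vd]; apply/asboolP; exists (u - v).
by rewrite !raddfB /= uc vd.
Qed.

HB.instance Definition _ := GRing.isZmodClosed.Build cycle1 is_bdry
  is_bdry_zmod_closed.

(* The first integral homology group, written additively. *)
Definition H1 : zmodType := {quot (GRing.ZmodClosed.clone cycle1 is_bdry _)}.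

(* The class of a 1-cycle; meaningless on chains which are not cycles. *)
Definition hclass (c : chain 1) : H1 := \pi_H1 (insubd (0 : cycle1) c).

(* The part of the curve [g] between the times a and b. *)
Definition arc_chain (g : continuousType R X) (a b : R) : chain 1 :=
  << (g \o segment a b : simplex 1) >>.

End Homology.
Arguments Delta R n : clear implicits.
Arguments H1 R X : clear implicits.
Arguments chain R X n : clear implicits.
Arguments hclass {R X} c.

(* Z[A] for an abelian group A written additively: the basis element attached
   to [x : A] is [<< x >>], so that the unit e is [<< 0 >>]. *)
Definition gring (A : zmodType) := {freeg A / int}.

Definition gmul (A : zmodType) (u v : gring A) : gring A :=
  fglift (fun x => fglift (fun y => << x + y >> : gring A) v) u.

Section QuotientModule.
Variables (A : zmodType) (k f : A).

(* The submodule of Z[A] generated by k - f and kf - e. *)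
Definition Hrel (u : gring A) : bool :=
  `[< exists m n : int,
     u = (<< k >> - << f >>) *~ m + (<< k + f >> - << 0 >>) *~ n >].

Lemma Hrel_zmod_closed : zmod_closed Hrel.
Proof.
split=> [|u v]; first by apply/asboolP; exists 0, 0; rewrite !mulr0z addr0.
move=> /asboolP[m [n ->]] /asboolP[m' [n' ->]]; apply/asboolP.
by exists (m - m'), (n - n'); rewrite !mulrzBr opprD addrACA.
Qed.

HB.instance Definition _ := GRing.isZmodClosed.Build (gring A) Hrel
  Hrel_zmod_closed.

Definition Hmod : zmodType :=
  {quot (GRing.ZmodClosed.clone (gring A) Hrel _)}.

Definition Hproj (u : gring A) : Hmod := \pi_Hmod u.

End QuotientModule.

Section Knots.
Context {R : realType} {N : oriented_manifold R 3} {F : oriented_manifold R 2}.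
Implicit Types (K : continuousType R N) (D : seq (R * R)) (a b s t : R).

(* An immersed circle whose only self-intersections are the points K a = K b,
   for (a, b) in the list D; these are pairwise distinct, double and
   transverse. *)
Definition singular_knot K D : Prop :=
  [/\ immersed_loop K,
      forall s t, K s = K t -> same_mod1 s t \/
        exists2 d, d \in D & (same_mod1 s d.1 /\ same_mod1 t d.2) \/
                             (same_mod1 s d.2 /\ same_mod1 t d.1),
      forall d, d \in D -> [/\ K d.1 = K d.2, ~ same_mod1 d.1 d.2 &
                               transverse_at K d.1 d.2] &
      uniq [seq K d.1 | d <- D]].

Definition knot K : Prop := singular_knot K [::].

Definition knot_class K : H1 R N := hclass (arc_chain K 0 1).

(* The class of the loop of K which leaves K a = K b at time a and comes back
   at the next time congruent to b. *)
Definition loop_class K a b : H1 R N := hclass (arc_chain K a (next_after a b)).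

Variable pi : circle_fibration N F.

Definition fiber_class (x : F) : H1 R N := hclass (arc_chain (fiber pi x) 0 1).

(* The positively oriented arc of fiber from p to q, when pi p = pi q. *)
Definition fiber_arc (p q : N) : chain R N 1 :=
  arc_chain (fiber pi (pi p)) (fiber_angle pi p)
    (next_after (fiber_angle pi p) (fiber_angle pi q)).

(* The class of the arc of K from time a to the next time congruent to b,
   closed up by the positive arc of fiber from its end to its start. *)
Definition closed_arc_class K a b : H1 R N :=
  hclass (arc_chain K a (next_after a b) + fiber_arc (K b) (K a)).

(* Each double point of the generic curve pi(K) is pi (K s) = pi (K t) for
   exactly one such pair: the order of s and t is fixed by the frame. *)
Definition double_points K : set (R * R) :=
  [set st | [/\ 0 <= st.1 < 1, 0 <= st.2 < 1, st.1 != st.2,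
     pi (K st.1) = pi (K st.2) & positive_frame (pi \o K) st.1 st.2]].

(* With both branches directed upwards, the branch at s = st.1 goes from lower
   left to upper right and the branch at t = st.2 from lower right to upper
   left.  After the oriented smoothing, the curve on the left thus arrives along
   the branch at s and leaves along the branch at t: it comes from the arc of K
   from t to s. *)
Definition mu_plus K (st : R * R) : H1 R N := closed_arc_class K st.2 st.1.
Definition mu_minus K (st : R * R) : H1 R N := closed_arc_class K st.1 st.2.

(* S_K as an element of the module H built from the class k, which is to be
   [knot_class K], and from the fiber class f. *)
Definition S_knot (k f : H1 R N) K : Hmod k f :=
  \sum_(st \in double_points K)
    Hproj k f (<< mu_plus K st >> - << mu_minus K st >>).

(* Along the family G of curves, which all project to the same curve, the
   branch at a moves above the branch at b in the positive direction of the
   fiber containing the common point of both branches at time 0. *)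
Definition moves_above (G : R -> continuousType R N) a b : Prop :=
  exists alpha beta : R -> R,
    [/\ {within `[0, 1], continuous alpha}, {within `[0, 1], continuous beta},
        alpha 0 = beta 0,
        forall r, 0 <= r <= 1 -> G r a = fiber pi (pi (G 0 a)) (alpha r) /\
                                 G r b = fiber pi (pi (G 0 b)) (beta r) &
        forall r, 0 < r <= 1 -> beta r < alpha r].

(* The sign of the resolution at the singular point K a = K b: true when
   (tangent of the upper branch, tangent of the lower one) projects to a
   positive frame. *)
Definition resolves_with_sign (G : R -> continuousType R N) a b (sg : bool) :=
  let eta := pi \o G 0 in
  let '(x, y) := if sg then (a, b) else (b, a) in
  (moves_above G a b /\ positive_frame eta x y) \/
  (moves_above G b a /\ positive_frame eta y x).

(* K is obtained from the singular knot K0, with singular points D, by moving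
   apart along the fibers the two branches at each singular point, with the
   signs listed in sgs.  The motion G does not affect the points of K0 over the
   other double points of the projection.  It goes through knots as soon as it
   has started, so that K has the isotopy type of arbitrarily small
   displacements and no bound on the size of the motion is needed. *)
Definition resolution K0 D (sgs : seq bool) K : Prop :=
  exists G : R -> continuousType R N,
    [/\ {within [set q : R * R | 0 <= q.1 <= 1],
          continuous (fun q : R * R => G q.1 q.2)},
        G 0 = K0 /\ G 1 = K,
        forall r, 0 < r <= 1 -> knot (G r),
        forall r s, 0 <= r <= 1 ->
          pi (G r s) = pi (K0 s) /\
          ((exists t, pi (K0 s) = pi (K0 t) /\ K0 s <> K0 t) ->
           G r s = K0 s) &
        size sgs = size D /\
        forall d sg, (d, sg) \in zip D sgs -> resolves_with_sign G d.1 d.2 sg].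

End Knots.

(* Main.v *)
Require Import Defs.
From HB Require Import structures.
From mathcomp Require Import all_boot all_order all_algebra.
From mathcomp Require Import generic_quotient ring_quotient.
From mathcomp Require Import finmap all_classical all_reals.
From mathcomp Require Import topology normedtype derive realfun.
From mathcomp Require Import freeg.
From mathcomp Require Import ring lra zify.
Set Implicit Arguments.
Unset Strict Implicit.
Unset Printing Implicit Defensive.
Import Order.TTheory GRing.Theory Num.Theory.
Import numFieldNormedType.Exports.
Import Quotient.
Local Open Scope quotient_scope.
Local Open Scope classical_set_scope.
Local Open Scope ring_scope.

(** All resolutions of a singular knot K' project to the same generic curve, so
    that their sums run over the same finite set of double points and can be
    compared term by term.

    At a double point of the projection which is not a singular point of K', the
    motion fixes the two points of the knot; it is a homotopy between the arcs
    of K' and those of the resolution, and the term does not change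
    ([crossing_term_fixed]).

    At a singular point K' a = K' b, let alpha and beta be the angles in the
    fiber of the two branches along a motion that raises the branch at a above
    the one at b.  They agree at time 0, and alpha - beta is positive afterwards;
    as the moving curve stays embedded, alpha - beta is never an integer, hence
    stays below 1 by the intermediate value theorem ([moves_above_gap]).  Pushing
    the arcs of the resolution back to those of K' along the motion, while their
    ends slide in the fiber, turns each closed-up arc into a loop of K' together
    with a number of turns around the fiber ([closed_arc_resolved]).  This number
    is 1 for the arc that starts on the lower branch and ends on the upper one,
    and 0 for the other.  So, with xi1 and xi2 the classes of the two loops, the
    terms of the positive and of the negative resolution are
    [xi1 + f] - [xi2] and [xi1] - [xi2 + f], up to exchanging xi1 and xi2, and
    their difference is (f - e)(xi1 + xi2), already in the group ring.  Since the
    term at one singular point only depends on the sign chosen there, the second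
    derivative vanishes term by term.

    Two facts about the setting enter.

    The class of the fiber is locally constant ([fiber_class_near]), so that the
    fiber over a singular point has the class of the fiber over the base point.
    Within one local trivialization this is a homotopy.  The positive fibers of
    two points are however defined by two trivializations, which have to be
    compared over a common point.  Two simple parametrizations of a circle are
    homologous up to a sign, and the sign can be read from the direction in which
    they run through one point ([circle_compare]); the ratio of the two velocity
    vectors there has the sign of the ratio of the two Jacobian determinants
    ([triv_compare]), because both trivializations lie over the identity of the
    base.

    The set of double points is finite ([double_points_finite]): pairs of distinct
    parameters with the same image are isolated, near the diagonal by Rolle's
    theorem since the curve is immersed, elsewhere by transversality.

    Homology classes are computed in the group of 1-chains modulo boundaries,
    where an arc which is not closed has a class [cls] as well, and where these
    classes add up along concatenations and change by the traces of the end
    points under homotopies. *)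

(** * Real numbers modulo 1 *)

Lemma periodicz (R : realType) (T : Type) (g : R -> T) :
  (forall t, g (t + 1) = g t) -> forall (n : int) t, g (t + n%:~R) = g t.
Proof.
move=> g1 n t; have gn (k : nat) s : g (s + k%:R) = g s.
  elim: k s => [|k IH] s; first by rewrite addr0.
  by rewrite -natr1 addrA g1.
case: n => n; first exact: gn.
by rewrite NegzE mulrNz -[LHS](gn n.+1) subrK.
Qed.

Section Modulo1.
Context {R : realType}.
Implicit Types s t u : R.

Lemma same_mod1P s t : same_mod1 s t <-> exists n : int, s = t + n%:~R.
Proof.
split; first by move=> /intrP[n st]; exists n; rewrite -st addrC subrK.
by move=> [n ->]; rewrite /same_mod1 addrC addKr intr_int.
Qed.

Lemma same_mod1C s t : same_mod1 s t -> same_mod1 t s.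
Proof. by rewrite /same_mod1 -rpredN opprB. Qed.

Lemma same_mod1_trans s t u : same_mod1 s t -> same_mod1 t u -> same_mod1 s u.
Proof. by rewrite /same_mod1 -[s - u](subrKA t) => ? ?; exact: rpredD. Qed.
End Modulo1.

Lemma same_mod1_eq (R : realType) (s t : R) : same_mod1 s t -> -1 < s - t < 1 -> s = t.
Proof.
move=> /same_mod1P[n ->]; rewrite addrC addKr => /andP[]. 
rewrite -[1]/(1%:~R) -[- 1]mulrN1z ?ltr_int => h1 h2.
have -> : n = 0 by lia.
by rewrite addr0.
Qed.

Section NextAfter.
Context {R : realType}.
Implicit Types a b : R.

Lemma next_afterP a b :
  exists2 n : int, next_after a b = b + n%:~R & a <= next_after a b < a + 1.
Proof.
exists (- Num.floor (b - a)); first by rewrite /next_after mulrNz.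
have /andP[h1 h2] := mem_rg1_floor (b - a).
by rewrite /next_after; lra.
Qed.

Lemma next_after_uniq a b (n : int) : a <= b + n%:~R < a + 1 ->
  next_after a b = b + n%:~R.
Proof.
move=> /andP[h1 h2]; rewrite /next_after -mulrNz; congr (_ + _%:~R).
have -> : Num.floor (b - a) = - n.
  by apply: floor_def; rewrite mulrzDr mulrNz; lra.
by rewrite opprK.
Qed.

Lemma next_after_shift a b (m n : int) :
  next_after (a + m%:~R) (b + n%:~R) = next_after a b + m%:~R.
Proof.
have [k -> ab] := next_afterP a b; have -> : b + k%:~R + m%:~R = b + n%:~R + (k + m - n)%:~R by rewrite !intrD mulrNz; ring.
by apply: next_after_uniq; rewrite !intrD mulrNz; lra.
Qed.
End NextAfter.

(** * Continuous maps and planar determinants *)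

Lemma continuous_pair (X Y Z : topologicalType) (f : X -> Y) (g : X -> Z) x :
  {for x, continuous f} -> {for x, continuous g} ->
  {for x, continuous (fun y => (f y, g y))}.
Proof. by move=> cf cg; exact: cvg_pair cf cg. Qed.

(** A motion is only continuous for times in [0, 1]; precomposing it with a map
    into that region gives a map continuous everywhere. *)
Lemma continuous_within_comp (X Y Z : topologicalType) (A : set Y) (h : X -> Y)
    (f : Y -> Z) :
  {within A, continuous f} -> continuous h -> (forall x, A (h x)) ->
  continuous (f \o h).
Proof.
move=> /subspace_continuousP cf ch Ah x.
apply: (@cvg_comp _ _ _ h f (nbhs x) (within A (nbhs (h x)))); last exact: cf.
move=> P wP.
have hW : nbhs x (h @^-1` [set y | A y -> P y]) by exact: ch x _ wP.
by apply: filterS hW => y Py; exact: Py (Ah y).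
Qed.

Lemma snd_cont (X Y : topologicalType) : continuous (snd : X * Y -> Y).
Proof. by move=> x; exact: cvg_snd. Qed.

Lemma det_mx2 (K : comNzRingType) (M : 'M[K]_2) :
  \det M = M 0 0 * M 1 1 - M 0 1 * M 1 0.
Proof.
have l0 : fintype.lift 0 0 = 1 :> 'I_2 by apply/val_inj.
have l1 : fintype.lift 1 0 = 0 :> 'I_2 by apply/val_inj.
rewrite (expand_det_row _ 0) !big_ord_recl big_ord0 addr0 /cofactor !det_mx11 !mxE.
by rewrite !l0 l1 /= expr0 expr1 mul1r mulN1r mulrN.
Qed.

Lemma det_mx2E (K : comNzRingType) (v w : 'rV[K]_2) :
  \det (col_mx v w : 'M_2) = v 0 0 * w 0 1 - v 0 1 * w 0 0.
Proof.
have e0 : lshift 1 (0 : 'I_1) = 0 by apply/val_inj.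
have e1 : rshift 1 (0 : 'I_1) = 1 by apply/val_inj.
have E0 j : (col_mx v w : 'M_2) 0 j = v 0 j by rewrite -e0; exact: col_mxEu.
have E1 j : (col_mx v w : 'M_2) 1 j = w 0 j by rewrite -e1; exact: col_mxEd.
by rewrite det_mx2 !E0 !E1.
Qed.

(** * One-dimensional chains modulo boundaries *)

Section ChainsModBoundaries.
Context {R : realType} {X : topologicalType}.
Local Notation simplex := (@simplex R X).
Local Notation chain := (chain R X).

Definition bounds (c : chain 1) : bool := `[< exists w : chain 2, bdry w = c >].

Lemma bounds_zmod_closed : zmod_closed bounds.
Proof.
split=> [|c d]; first by apply/asboolP; exists 0; rewrite raddf0.
move=> /asboolP[u <-] /asboolP[v <-]; apply/asboolP.
by exists (u - v); rewrite raddfB.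
Qed.

HB.instance Definition _ := GRing.isZmodClosed.Build (chain 1) bounds
  bounds_zmod_closed.

(** The quotient is taken on all 1-chains and not only on cycles, so that arcs
    with distinct end points have classes which can be added. *)
Definition chains_mod : zmodType :=
  {quot (GRing.ZmodClosed.clone (chain 1) bounds _)}.

Definition cls (c : chain 1) : chains_mod := \pi_chains_mod c.

Lemma cls_is_additive : zmod_morphism cls.
Proof. by move=> c d; rewrite /cls raddfB. Qed.

HB.instance Definition _ := GRing.isZmodMorphism.Build (chain 1) chains_mod
  cls cls_is_additive.

Lemma cls_eqP (c d : chain 1) :
  cls c = cls d <-> exists w : chain 2, bdry w = c - d.
Proof.
have E : (cls c == cls d) = bounds (c - d).
  exact: esym (@idealrBE _ (GRing.ZmodClosed.clone (chain 1) bounds _) c d).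
split=> [/eqP|h]; first by rewrite E => /asboolP.
by apply/eqP; rewrite E; apply/asboolP.
Qed.

Lemma hclassB (c d : chain 1) : is_cycle c -> is_cycle d ->
  hclass (c - d) = hclass c - hclass d.
Proof.
move=> hc hd; rewrite /hclass -raddfB.
congr (\pi); apply: val_inj; rewrite raddfB /= !insubdK //.
exact: (@rpredB _ (GRing.ZmodClosed.clone (chain 1) (@is_cycle R X) _)).
Qed.

(** The homology group embeds in the group of chains modulo boundaries. *)
Lemma hclass_cls (c d : chain 1) : is_cycle c -> is_cycle d ->
  cls c = cls d -> hclass c = hclass d.
Proof.
move=> hc hd /cls_eqP cd; apply/eqP; rewrite /hclass.
rewrite -(@idealrBE _ (GRing.ZmodClosed.clone (@cycle1 R X) (@is_bdry R X) _)).
by apply/asboolP; rewrite raddfB /= !insubdK.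
Qed.
End ChainsModBoundaries.

Section AffineSimplices.
Context {R : realType} {X : topologicalType}.
Local Notation simplex := (@simplex R X).
Local Notation chain := (chain R X).

(** The affine map with prescribed values at the vertices of the simplex. *)
Definition affine n (p : 'I_n.+1 -> R * R) (x : Delta R n) : R * R :=
  (\sum_i val x 0 i * (p i).1, \sum_i val x 0 i * (p i).2).

Lemma affine_continuous n p : continuous (@affine n p).
Proof.
have lin (w : 'I_n.+1 -> R) : continuous (fun x : Delta R n => \sum_i val x 0 i * w i).
  apply: continuous_big => [|i _ x]; first exact: add_continuous.
  exact: (@continuous_comp _ _ _ (fun y : Delta R n => val y 0 i)
    (fun u => u * w i) x (@bary_continuous R n i x) (@mulrr_continuous _ _ _)).
by move=> x; exact: cvg_pair (lin _ x) (lin _ x).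
Qed.

HB.instance Definition _ n p := isContinuous.Build _ _ (@affine n p)
  (@affine_continuous n p).

Lemma affine_face n (p : 'I_n.+2 -> R * R) i :
  affine p \o @face R n i = affine (p \o fintype.lift i).
Proof.
apply/funext => x; rewrite /affine /=; congr (_, _);
  rewrite (bigD1_ord i) //= mxE unlift_none mul0r add0r;
  by apply: eq_bigr => k _; rewrite mxE liftK.
Qed.

Definition edge (Phi : continuousType (R * R)%type X) (p q : R * R) : chain 1 :=
  << (Phi \o affine (fun i => nth p [:: p; q] i) : simplex 1) >>.

Lemma bdry_triangle (Phi : continuousType (R * R)%type X) p q r :
  bdry << (Phi \o affine (fun i => nth p [:: p; q; r] i) : simplex 2) >> =
  edge Phi q r - edge Phi p r + edge Phi p q.
Proof.
rewrite /bdry liftU scale1r !big_ord_recl big_ord0 /= addr0.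
rewrite expr0 expr1 -signr_odd /= expr0 -freegUN addrA.
by congr (_ - _ + _); congr << _ >>; apply/continuousEP => x /=;
  congr (Phi _); rewrite -[LHS]/((affine _ \o @face R _ _) x) affine_face;
  congr affine; apply/funext => -[[|[|]]].
Qed.
End AffineSimplices.

Section Arcs.
Context {R : realType} {X : topologicalType}.
Implicit Types (g e ea eb : continuousType R X).

(** The boundary of the image of an affine triangle of the plane. *)
Lemma cls_triangle (Phi : continuousType (R * R)%type X) p q r :
  cls (edge Phi p q) + cls (edge Phi q r) = cls (edge Phi p r).
Proof.
rewrite -raddfD; apply/cls_eqP.
exists << (Phi \o affine (fun i => nth p [:: p; q; r] i) : simplex _ 2) >>.
by rewrite bdry_triangle addrAC (addrC (edge Phi p q)).
Qed.

Lemma edge_arc (Phi : continuousType (R * R)%type X) g p q a b :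
  (forall u v, 0 <= u -> 0 <= v -> u + v = 1 ->
    Phi (u * p.1 + v * q.1, u * p.2 + v * q.2) = g (u * a + v * b)) ->
  edge Phi p q = arc_chain g a b.
Proof.
move=> E; rewrite /edge /arc_chain; congr << _ >>; apply/continuousEP => x /=.
rewrite /affine /segment !big_ord_recl !big_ord0 /= !addr0.
case: x => x /= /set_mem [x0 x1]; have -> : fintype.lift ord0 ord0 = 1 :> 'I_2 by apply/val_inj.
by apply: E => //; rewrite -x1 !big_ord_recl big_ord0 addr0; congr (_ + x _ _); apply/val_inj.
Qed.

Lemma eq_arc g g' a b a' b' :
  (forall u v, 0 <= u -> 0 <= v -> u + v = 1 ->
    g (u * a + v * b) = g' (u * a' + v * b')) ->
  arc_chain g a b = arc_chain g' a' b'.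
Proof.
move=> E; rewrite /arc_chain; congr << _ >>; apply/continuousEP => x /=.
rewrite /segment; case: x => x /= /set_mem [x0 x1].
by apply: E => //; rewrite -x1 !big_ord_recl big_ord0 addr0; congr (_ + x _ _); apply/val_inj.
Qed.

(** This is the boundary of g composed with the second projection, on the
    degenerate triangle with vertices (0, a), (0, b), (0, c). *)
Lemma cls_arcD g a b c :
  cls (arc_chain g a b) + cls (arc_chain g b c) = cls (arc_chain g a c).
Proof.
pose Phi : continuousType (R * R)%type X := g \o mkcts (@snd_cont R R).
have E x y : arc_chain g x y = edge Phi (0, x) (0, y) by exact/esym/edge_arc.
by rewrite !E cls_triangle.
Qed.

Lemma cls_arcxx g a : cls (arc_chain g a a) = 0.
Proof. by apply: (@addrI _ (cls (arc_chain g a a))); rewrite cls_arcD addr0. Qed.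

Lemma cls_arcN g a b : cls (arc_chain g a b) = - cls (arc_chain g b a).
Proof. by apply/eqP; rewrite -addr_eq0 cls_arcD cls_arcxx. Qed.

Lemma cls_arc_cst g a b : (forall t, g t = g a) -> cls (arc_chain g a b) = 0.
Proof.
move=> E; rewrite -(cls_arcxx g a); congr cls; apply: eq_arc => u v _ _ _.
by rewrite E [RHS]E.
Qed.

Definition clamp (r : R) : R := Num.max 0 (Num.min 1 r).

Lemma clamp_continuous : continuous clamp.
Proof.
move=> r; apply: (@continuous_max R R (cst 0) (fun s => Num.min 1 s)).
  exact: cvg_cst.
by apply: (@continuous_min R R (cst 1) id); [exact: cvg_cst | exact: cvg_id].
Qed.

Lemma clamp_itv r : 0 <= clamp r <= 1.
Proof. by rewrite /clamp le_max lexx /= ge_max ler01 ge_min lexx. Qed.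

Lemma clamp_id r : 0 <= r <= 1 -> clamp r = r.
Proof.
by move=> /andP[r0 r1]; rewrite /clamp (min_idPr r1) (max_idPr r0).
Qed.

(** The square swept by the homotopy is cut into two triangles along its
    diagonal; [ea] and [eb] are the traces of the end points. *)
Lemma cls_homotopy (G : R -> R -> X) g0 g1 ea eb a b :
  {within [set q : R * R | 0 <= q.1 <= 1],
      continuous (fun q : R * R => G q.1 q.2)} ->
  G 0 =1 g0 -> G 1 =1 g1 ->
  (forall r, 0 <= r <= 1 -> G r a = ea r) ->
  (forall r, 0 <= r <= 1 -> G r b = eb r) ->
  cls (arc_chain g1 a b) =
  cls (arc_chain g0 a b) + cls (arc_chain eb 0 1) - cls (arc_chain ea 0 1).
Proof.
move=> cG G0 G1 Ga Gb.
pose cl (q : R * R) := (clamp q.1, q.2).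
have ccl : continuous cl.
  move=> q; apply: (@continuous_pair _ _ _ (fun q => clamp q.1) snd); last exact: cvg_snd.
  apply: (@continuous_comp _ _ _ fst clamp); first exact: cvg_fst.
  exact: clamp_continuous.
pose Phi : continuousType (R * R)%type X :=
  mkcts (continuous_within_comp cG ccl (fun q => clamp_itv q.1)).
have PhiE r s : 0 <= r <= 1 -> Phi (r, s) = G r s.
  by move=> r01; rewrite -[LHS]/(G (clamp r) s) clamp_id.
have E0 : arc_chain g0 a b = edge Phi (0, a) (0, b).
  by apply/esym/edge_arc => u v _ _ _ /=; rewrite !mulr0 addr0 PhiE ?lexx ?ler01.
have E1 : arc_chain g1 a b = edge Phi (1, a) (1, b).
  by apply/esym/edge_arc => u v _ _ uv /=; rewrite !mulr1 uv PhiE ?lexx ?ler01.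
have Eend c e : (forall r, 0 <= r <= 1 -> G r c = e r) ->
    arc_chain e 0 1 = edge Phi (0, c) (1, c).
  move=> Gc; apply/esym/edge_arc => u v u0 v0 uv /=.
  have v01 : 0 <= v <= 1 by rewrite v0 -uv lerDr.
  by rewrite !mulr0 !add0r !mulr1 -mulrDl uv mul1r PhiE // Gc.
rewrite E0 E1 (Eend a ea) // (Eend b eb) //.
by rewrite cls_triangle -(cls_triangle Phi (0, a) (1, a)) addrAC subrr add0r.
Qed.

(** The map h is homotopic, with fixed end points, to the affine map with the
    same end values; constant traces have class 0. *)
Lemma cls_reparam g (h : R -> R) e :
  {within `[0, 1], continuous h} -> (forall r, 0 <= r <= 1 -> e r = g (h r)) ->
  cls (arc_chain e 0 1) = cls (arc_chain g (h 0) (h 1)).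
Proof.
move=> ch eh.
have chc : continuous (h \o clamp).
  apply: continuous_within_comp ch clamp_continuous _ => r.
  by rewrite /= in_itv /= clamp_itv.
pose lin s := (1 - s) * h 0 + s * h 1.
have clin : continuous lin.
  move=> s; apply: cvgD; apply: cvgMl; last exact: cvg_id.
  by apply: cvgB; [exact: cvg_cst | exact: cvg_id].
pose G r s := g ((1 - r) * h (clamp s) + r * lin s).
have cG : continuous (fun q : R * R => G q.1 q.2).
  move=> q; apply: (@continuous_comp (R * R)%type R X
    (fun q => (1 - q.1) * h (clamp q.2) + q.1 * lin q.2) g q); last exact: cts_fun.
  apply: cvgD; apply: cvgM.
  - by apply: cvgB; [exact: cvg_cst | exact: cvg_fst].
  - by apply: (@continuous_comp _ _ _ snd (h \o clamp)); [exact: cvg_snd | exact: chc].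
  - exact: cvg_fst.
  - by apply: (@continuous_comp _ _ _ snd lin); [exact: cvg_snd | exact: clin].
pose k c : continuousType R X := mkcts (@cst_continuous R X c).
have := @cls_homotopy G (g \o mkcts chc) (g \o mkcts clin) (k (g (h 0)))
  (k (g (h 1))) 0 1 (continuous_subspaceT cG).
rewrite (cls_arc_cst (g := k (g (h 0)))) // (cls_arc_cst (g := k (g (h 1)))) // subr0 addr0.
have E0 : arc_chain e 0 1 = arc_chain (g \o mkcts chc) 0 1.
  apply: eq_arc => u v u0 v0 uv /=; have v01 : 0 <= v <= 1 by rewrite v0 -uv lerDr.
  by rewrite !mulr0 !mulr1 !add0r eh // -[RHS]/(g (h (clamp v))) clamp_id.
have E1 : arc_chain g (h 0) (h 1) = arc_chain (g \o mkcts clin) 0 1.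
  apply: eq_arc => u v _ _ uv /=; rewrite !mulr0 !mulr1 !add0r /mkcts /lin.
  by rewrite -uv addrK.
rewrite E0 E1 => -> //= s.
- by rewrite /G subr0 mul1r mul0r addr0.
- by rewrite /G subrr mul1r mul0r add0r.
- move=> _; rewrite /G clamp_id ?lexx ?ler01 // /lin subr0 mul1r mul0r addr0.
  by rewrite -mulrDl subrK mul1r.
- move=> _; rewrite /G clamp_id ?lexx ?ler01 // /lin subrr mul1r mul0r add0r.
  by rewrite -mulrDl subrK mul1r.
Qed.

Section Periodic.
Variable g : continuousType R X.
Hypothesis g1 : forall t, g (t + 1) = g t.

Lemma arc_shift (n : int) a b :
  arc_chain g (a + n%:~R) (b + n%:~R) = arc_chain g a b.
Proof.
apply: eq_arc => u v _ _ uv.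
by rewrite -[in RHS](periodicz g1 n) -[in RHS](mul1r n%:~R) -uv; congr (g _); ring.
Qed.

Lemma cls_loop a : cls (arc_chain g a (a + 1)) = cls (arc_chain g 0 1).
Proof.
apply: (@addrI _ (cls (arc_chain g 0 a))); rewrite cls_arcD.
by rewrite -(cls_arcD g 0 1) addrC -(arc_shift 1 0 a) add0r.
Qed.

(** The class of an arc of n periods is n times the class of the loop, wherever
    the arc starts. *)
Lemma cls_loopz (n : int) a :
  cls (arc_chain g a (a + n%:~R)) = cls (arc_chain g 0 1) *~ n.
Proof.
have H (k : nat) s : cls (arc_chain g s (s + k%:R)) = cls (arc_chain g 0 1) *+ k.
  elim: k s => [|k IH] s; first by rewrite addr0 cls_arcxx.
  by rewrite [RHS]mulrSr -(IH s) -(cls_loop (s + k%:R)) cls_arcD -natr1 addrA.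
case: n => n; first exact: H.
rewrite NegzE mulrNz [in RHS]mulrNz cls_arcN; congr (- _).
by rewrite -[RHS](H n.+1 (a - n.+1%:R)) subrK.
Qed.
End Periodic.
End Arcs.

(** The two end points move along the same path, so their traces cancel. *)
Lemma cls_free_homotopy (R : realType) (X : topologicalType) (G : R -> R -> X)
    (g0 g1 : continuousType R X) (a b : R) :
  {within [set q : R * R | 0 <= q.1 <= 1],
      continuous (fun q : R * R => G q.1 q.2)} ->
  G 0 =1 g0 -> G 1 =1 g1 ->
  (forall r, 0 <= r <= 1 -> G r a = G r b) ->
  cls (arc_chain g1 a b) = cls (arc_chain g0 a b).
Proof.
move=> cG G0 G1 Gab.
have ce : continuous ((fun q : R * R => G q.1 q.2) \o (fun r => (clamp r, a))).
  apply: (continuous_within_comp cG) => [r|r]; last exact: clamp_itv.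
  by apply: continuous_pair; [exact: clamp_continuous | exact: cvg_cst].
have eE (r : R) : 0 <= r <= 1 -> mkcts ce r = G r a.
  by move=> r01; rewrite -[LHS]/(G (clamp r) a) clamp_id.
rewrite (cls_homotopy (ea := mkcts ce) (eb := mkcts ce) cG G0 G1) ?addrK // => r r01.
  exact/esym/eE.
by rewrite -Gab //; exact/esym/eE.
Qed.

Section Cycles.
Context {R : realType} {X : topologicalType}.
Implicit Types (g e : continuousType R X) (c d : chain R X 1).

Definition point_simplex (x : X) : @simplex R X 0 := mkcts (@cst_continuous (Delta R 0) X x).

Lemma bdry_arc g a b : bdry (arc_chain g a b) =
  << point_simplex (g b) >> - << point_simplex (g a) >>.
Proof.
rewrite /bdry /arc_chain liftU scale1r !big_ord_recl big_ord0 /= addr0.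
rewrite expr0 expr1 -freegUN.
have E (x : Delta R 0) : val x 0 0 = 1.
  by case: x => x /= /set_mem[_]; rewrite big_ord1.
have e1 : fintype.lift ord0 ord0 = 1 :> 'I_2 by apply/val_inj.
have u01 : unlift ord0 (1 : 'I_2) = Some 0 by rewrite -e1 liftK.
have u10 : unlift (1 : 'I_2) 0 = Some 0.
  by rewrite -[X in unlift _ X](_ : fintype.lift 1 ord0 = 0) ?liftK //; apply/val_inj.
congr (_ - _); congr << _ >>; apply/continuousEP => x /=;
  rewrite /segment /= /face_row !mxE.
  by rewrite unlift_none u01 E mul0r add0r mul1r.
by rewrite e1 unlift_none u10 E mul0r addr0 mul1r.
Qed.

Lemma is_cycle0 : is_cycle (0 : chain R X 1).
Proof. exact: (@rpred0 _ (GRing.ZmodClosed.clone _ (@is_cycle R X) _)). Qed.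

Lemma is_cycleD c d : is_cycle c -> is_cycle d -> is_cycle (c + d).
Proof. exact: (@rpredD _ (GRing.ZmodClosed.clone _ (@is_cycle R X) _)). Qed.

Lemma is_cycleMn c n : is_cycle c -> is_cycle (c *+ n).
Proof. by move=> hc; elim: n => [|n IH]; rewrite ?is_cycle0 // mulrS is_cycleD. Qed.

Lemma hclass0 : hclass (0 : chain R X 1) = 0.
Proof. by rewrite -(subrr (0 : chain R X 1)) hclassB ?is_cycle0 // subrr. Qed.

Lemma hclassD c d : is_cycle c -> is_cycle d -> hclass (c + d) = hclass c + hclass d.
Proof.
move=> hc hd; rewrite -[in RHS](addrK d c) hclassB ?is_cycleD //.
by rewrite subrK.
Qed.

Lemma hclassMn c n : is_cycle c -> hclass (c *+ n) = hclass c *+ n.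
Proof.
move=> hc; elim: n => [|n IH]; first by rewrite !mulr0n hclass0.
by rewrite !mulrS hclassD ?is_cycleMn // IH.
Qed.

Lemma is_cycle_loop g a b : g a = g b -> is_cycle (arc_chain g a b).
Proof. by move=> ab; rewrite /is_cycle bdry_arc ab subrr. Qed.

Lemma is_cycle_arc2 g a b e s t : g b = e s -> e t = g a ->
  is_cycle (arc_chain g a b + arc_chain e s t).
Proof.
move=> be ta; rewrite /is_cycle raddfD /= !bdry_arc be ta addrC addrA subrK.
by rewrite subrr.
Qed.
End Cycles.

(** * Arcs closed up along a fiber *)

Section FiberBasics.
Context {R : realType} {N : oriented_manifold R 3} {F : oriented_manifold R 2}.
Variable pi : circle_fibration N F.
Implicit Types (x : F) (p : N) (s t : R).

Lemma fiber_sign_cases x : fiber_sign pi x = 1 \/ fiber_sign pi x = -1.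
Proof. by rewrite /fiber_sign; case: ifP; [left|right]. Qed.

Lemma proj_fiber x t : pi (fiber pi x t) = x.
Proof. by have [[_ h _ _ _] bx] := triv_atP pi x; case: (h x (fiber_sign pi x * t) bx). Qed.

Lemma triv_map_periodic (tau : trivialization N F) x (n : int) t :
  is_trivialization pi tau -> triv_base tau x ->
  triv_map tau x (t + n%:~R) = triv_map tau x t.
Proof.
move=> [_ h _ _ _] bx; apply: (@periodicz R N (triv_map tau x)) => s.
by case: (h x s bx).
Qed.

Lemma fiber_periodic x t : fiber pi x (t + 1) = fiber pi x t.
Proof.
have [ht bx] := triv_atP pi x; rewrite /fiber.
case: (fiber_sign_cases x) => ->; rewrite ?mul1r ?mulN1r.
  exact: (triv_map_periodic 1 _ ht bx).
by rewrite opprD; exact: (triv_map_periodic (-1) _ ht bx).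
Qed.

Lemma fiber_angleK p : fiber pi (pi p) (fiber_angle pi p) = p.
Proof.
have [[_ _ [h _] _ _] bx] := triv_atP pi (pi p).
rewrite /fiber /fiber_angle mulrA.
have -> : fiber_sign pi (pi p) * fiber_sign pi (pi p) = 1.
  by case: (fiber_sign_cases (pi p)) => ->; rewrite ?mulrNN mulr1.
by rewrite mul1r h.
Qed.

Lemma fiber_inj x s t : fiber pi x s = fiber pi x t -> same_mod1 s t.
Proof.
have [[_ _ [_ h] _ _] bx] := triv_atP pi x => /(h _ _ _ bx).
rewrite /same_mod1 -mulrBr; case: (fiber_sign_cases x) => ->.
  by rewrite mul1r.
by rewrite mulN1r rpredN.
Qed.
End FiberBasics.

Section ResolvedCrossing.
Context {R : realType} {N : oriented_manifold R 3} {F : oriented_manifold R 2}.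
Variable pi : circle_fibration N F.
Implicit Types (K : continuousType R N) (G : R -> continuousType R N).

(** The angles chosen in the definition of the closing arc may be replaced by any
    other ones, as the fiber is periodic. *)
Lemma fiber_arc_lift (p q : N) (s t : R) (n : nat) :
  pi p = pi q -> p = fiber pi (pi p) s -> q = fiber pi (pi p) t ->
  s <= t + n%:R < s + 1 ->
  fiber_arc pi p q = arc_chain (fiber pi (pi p)) s (t + n%:R).
Proof.
move=> pq ps qt st; rewrite /fiber_arc.
have /same_mod1P[j ->] : same_mod1 (fiber_angle pi p) s.
  by apply: (@fiber_inj _ _ _ pi (pi p)); rewrite fiber_angleK -ps.
have /same_mod1P[k ->] : same_mod1 (fiber_angle pi q) t.
  by apply: (@fiber_inj _ _ _ pi (pi p)); rewrite {1}pq fiber_angleK -qt.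
rewrite next_after_shift (@next_after_uniq _ s t n) //.
exact: (arc_shift (fiber_periodic pi (pi p)) j).
Qed.

(** The angles [ta] and [tb] are those of the two branches along the motion.  The
    traces of the two ends contribute the arcs of fiber from tb 0 to tb 1 and
    from ta 0 to ta 1, the latter with a minus sign; the closing arc of fiber goes
    from tb 1 to ta 1 + n.  Since ta 0 = tb 0, they add up to n turns. *)
Lemma closed_arc_resolved G K0 K a b (ta tb : R -> R) (n : nat) :
  {within [set q : R * R | 0 <= q.1 <= 1],
          continuous (fun q : R * R => G q.1 q.2)} ->
  G 0 = K0 -> G 1 = K ->
  (forall r t, 0 <= r <= 1 -> G r (t + 1) = G r t) ->
  {within `[0, 1], continuous ta} -> {within `[0, 1], continuous tb} ->
  ta 0 = tb 0 ->
  (forall r, 0 <= r <= 1 -> G r a = fiber pi (pi (K0 a)) (ta r)) ->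
  (forall r, 0 <= r <= 1 -> G r b = fiber pi (pi (K0 a)) (tb r)) ->
  tb 1 <= ta 1 + n%:R < tb 1 + 1 ->
  closed_arc_class pi K a b =
    loop_class K0 a b + fiber_class pi (pi (K0 a)) *+ n.
Proof.
move=> cG G0 G1 Gper cta ctb tab0 Ga Gb ltn.
set x := pi (K0 a) in Ga Gb *; pose phi : continuousType R N := fiber pi x.
have r0 : 0 <= (0 : R) <= 1 by rewrite lexx ler01.
have r1 : 0 <= (1 : R) <= 1 by rewrite lexx ler01.
have Ka : K a = phi (ta 1) by rewrite -G1 Ga.
have Kb : K b = phi (tb 1) by rewrite -G1 Gb.
have K0ab : K0 a = K0 b by rewrite -G0 Ga // Gb // tab0.
have [m eb mab] := next_afterP a b.
have Gb' r : 0 <= r <= 1 -> G r (next_after a b) = phi (tb r).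
  move=> r01; rewrite eb -[RHS]/(fiber pi x (tb r)) -Gb //.
  by apply: periodicz => t; exact: Gper.
have fE : fiber_arc pi (K b) (K a) = arc_chain phi (tb 1) (ta 1 + n%:R).
  have xE : pi (K b) = x by rewrite Kb proj_fiber.
  have xE' : pi (K a) = x by rewrite Ka proj_fiber.
  by rewrite (fiber_arc_lift (etrans xE (esym xE')) _ _ ltn) xE.
have cclamp (h : R -> R) : {within `[0, 1], continuous h} -> continuous (h \o clamp).
  move=> ch; apply: continuous_within_comp ch (@clamp_continuous R) _ => r.
  by rewrite /= in_itv /= clamp_itv.
pose ea : continuousType R N := phi \o mkcts (cclamp _ cta).
pose ebb : continuousType R N := phi \o mkcts (cclamp _ ctb).
have eaE r : 0 <= r <= 1 -> ea r = phi (ta r).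
  by move=> r01; rewrite -[LHS]/(phi (ta (clamp r))) clamp_id.
have ebE r : 0 <= r <= 1 -> ebb r = phi (tb r).
  by move=> r01; rewrite -[LHS]/(phi (tb (clamp r))) clamp_id.
have H : cls (arc_chain K a (next_after a b)) =
   cls (arc_chain K0 a (next_after a b)) + cls (arc_chain ebb 0 1) - cls (arc_chain ea 0 1).
  apply: (@cls_homotopy _ _ G) => //.
  - by move=> t; rewrite G0.
  - by move=> t; rewrite G1.
  - by move=> r r01; rewrite Ga // eaE.
  - by move=> r r01; rewrite Gb' // ebE.
rewrite (cls_reparam cta eaE) (cls_reparam ctb ebE) in H.
rewrite /closed_arc_class fE /loop_class /fiber_class -/x.
have cyc0 : is_cycle (arc_chain K0 a (next_after a b)).
  by apply: is_cycle_loop; rewrite -G0 Gb' // Ga // tab0.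
have cycf : is_cycle (arc_chain phi 0 1).
  by apply: is_cycle_loop; rewrite -[in RHS](add0r 1); exact/esym/fiber_periodic.
rewrite -hclassMn // -hclassD ?is_cycleMn //; apply: hclass_cls.
- apply: is_cycle_arc2; first by rewrite -{1}G1 Gb'.
  by rewrite Ka; apply: (periodicz (fiber_periodic pi x) n).
- by rewrite is_cycleD ?is_cycleMn.
rewrite !raddfD raddfMn /= H -!addrA; congr (_ + _).
rewrite [- _ + _]addrC addrA cls_arcD -tab0 -cls_arcN addrC cls_arcD.
exact: (cls_loopz (fiber_periodic pi x) n).
Qed.
End ResolvedCrossing.

(** * Jacobians, charts and velocities *)

Section Jacobians.
Context {R : realType}.

Lemma smooth_differentiable (V W : normedModType R) (f : V -> W) x :
  smooth_at f x -> differentiable f x.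
Proof. by move=> [U [_ Ux /(_ 1%N) [df _]]]; exact: df. Qed.

Lemma smooth_near_differentiable (V W : normedModType R) (f : V -> W) x :
  smooth_at f x -> \forall y \near x, differentiable f y.
Proof.
move=> [U [oU Ux /(_ 1%N) [df _]]].
by apply: filterS df _; exact: open_nbhs_nbhs.
Qed.

Lemma smooth_derive_continuous (V W : normedModType R) (f : V -> W) x v :
  smooth_at f x -> {for x, continuous (fun y => 'D_v f y)}.
Proof.
move=> [U [oU Ux /(_ 2%N) [_ /(_ v)[df _]]]].
exact/differentiable_continuous/df.
Qed.

Lemma jacobian_comp m n p (f : 'rV[R]_m -> 'rV[R]_n) (g : 'rV[R]_n -> 'rV[R]_p) x :
  differentiable f x -> differentiable g (f x) ->
  'J (g \o f) x = 'J f x *m 'J g (f x).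
Proof.
move=> df dg.
apply/row_matrixP => i.
rewrite [LHS]rowE [RHS]rowE mulmxA.
rewrite -(deriveEjacobian _ df).
rewrite -(deriveEjacobian _ (differentiable_comp df dg)).

rewrite -(deriveEjacobian _ dg) !deriveE //; last exact: differentiable_comp.
by rewrite diff_comp.
Qed.

Lemma near_eq_jacobian m n (f g : 'rV[R]_m -> 'rV[R]_n) x :
  differentiable f x -> differentiable g x -> (\near x, f x = g x) ->
  'J f x = 'J g x.
Proof.
move=> df dg fg.
apply/row_matrixP => i.
rewrite [LHS]rowE [RHS]rowE.
rewrite -[LHS](deriveEjacobian _ df) -[RHS](deriveEjacobian _ dg).
exact: near_eq_derive.
Qed.

Lemma near_eq_continuous (T U : topologicalType) (f g : T -> U) x :
  (\forall y \near x, f y = g y) -> {for x, continuous f} ->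
  {for x, continuous g}.
Proof.
move=> E; rewrite /prop_for /continuous_at -(nbhs_singleton E).
by apply: cvg_trans; exact: near_eq_cvg E.
Qed.

Lemma mx_continuous (T : topologicalType) m n (M : T -> 'M[R]_(m, n)) x :
  (forall i j, {for x, continuous (fun y => M y i j)}) -> {for x, continuous M}.
Proof.
move=> cM A [P Px PA].
suff : nbhs x [set y | forall i j, P i j (M y i j)].
  by apply: filterS => y Py; exact: PA.
apply: filter_forall => i; apply: filter_forall => j.
exact: (cM i j) (Px i j).
Qed.

Lemma det_continuous (T : topologicalType) n (M : T -> 'M[R]_n) x :
  (forall i j, {for x, continuous (fun y => M y i j)}) ->
  {for x, continuous (fun y => \det (M y))}.
Proof.
move=> cM; rewrite /determinant.
apply: cvg_big => [|s _]; first exact: add_continuous.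
apply: cvgM; first exact: cvg_cst.
by apply: cvg_big => [|i _]; [exact: mul_continuous | exact: cM].
Qed.

(** Near x the entries of the Jacobian matrix are directional derivatives, and
    the determinant is a polynomial in them. *)
Lemma det_jacobian_continuous n (f : 'rV[R]_n -> 'rV[R]_n) x :
  smooth_at f x -> {for x, continuous (fun y => \det ('J f y))}.
Proof.
move=> sf; apply: det_continuous => i j.
have E : \forall y \near x, 'D_(delta_mx 0 i) f y 0 j = 'J f y i j.
  apply: filterS (smooth_near_differentiable sf) => y dy.
  by rewrite deriveEjacobian // -rowE mxE.
apply: (near_eq_continuous E).
apply: (@continuous_comp _ _ _ (fun y => 'D_(delta_mx 0 i) f y) (fun M => M 0 j)).
  exact: smooth_derive_continuous.
exact: coord_continuous.
Qed.

Lemma derive_comp_curve n p (f : R^o -> 'rV[R]_n) (g : 'rV[R]_n -> 'rV[R]_p) t :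
  differentiable f t -> differentiable g (f t) ->
  'D_1 (g \o f) t = 'D_1 f t *m 'J g (f t).
Proof.
move=> df dg; rewrite deriveE; last exact: differentiable_comp.
by rewrite diff_comp //= -deriveE // -deriveE // deriveEjacobian.
Qed.

End Jacobians.

Section Charts.
Context {R : realType} {n : nat} {M : oriented_manifold R n}.
Implicit Types (c d : @chart R n M) (x : M).

Lemma within_open_continuous (X Y : topologicalType) (A : set X) (f : X -> Y) (x : X) :
  open A -> {within A, continuous f} -> A x -> {for x, continuous f}.
Proof.
by move=> oA cf Ax; move: cf; rewrite continuous_open_subspace // => cf;
  apply: cf; exact/mem_set.
Qed.

Lemma chart_continuous c x : atlas c -> chart_dom c x -> {for x, continuous c}.
Proof.
move=> /atlas_chart[oc _ cc _ _] cx.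
by exact: (within_open_continuous oc cc).
Qed.

Lemma chart_invK c x : atlas c -> chart_dom c x -> chart_inv c (c x) = x.
Proof. by move=> /atlas_chart[_ _ _ _]; apply. Qed.

Lemma chart_inv_continuous c x : atlas c -> chart_dom c x ->
  {for c x, continuous (chart_inv c)}.
Proof.
move=> /atlas_chart[_ oc _ cc _] cx.
by apply: (within_open_continuous oc cc); exists x.
Qed.

Lemma chart_near_dom c x : atlas c -> chart_dom c x ->
  \forall y \near x, chart_dom c y.
Proof. by move=> /atlas_chart[oc _ _ _ _] cx; exact: open_nbhs_nbhs. Qed.

Lemma chart_near_image c x : atlas c -> chart_dom c x ->
  \forall y \near c x, chart_dom c (chart_inv c y) /\ c (chart_inv c y) = y.
Proof.
move=> /[dup] ac /atlas_chart[_ oc _ _ _] cx.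
have : nbhs (c x) (c @` chart_dom c) by apply: open_nbhs_nbhs; split => //; exists x.
by apply: filterS => _ [z cz <-]; rewrite chart_invK.
Qed.

Lemma transition_differentiable c d x : atlas c -> atlas d -> chart_dom c x -> chart_dom d x ->
  differentiable (d \o chart_inv c) (c x).
Proof.
by move=> ac ad cx dx; apply: smooth_differentiable; case: (atlas_transition ac ad cx dx).
Qed.

Lemma transition_det c d x : atlas c -> atlas d -> chart_dom c x -> chart_dom d x ->
  0 < \det ('J (d \o chart_inv c) (c x)).
Proof. by move=> ac ad cx dx; case: (atlas_transition ac ad cx dx). Qed.

End Charts.

Section Velocities.
Context {R : realType} {n : nat} {M : oriented_manifold R n}.
Implicit Types (c d : @chart R n M) (eta : R -> M).

Lemma derive_transition c d eta t :
  {for t, continuous eta} ->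
  differentiable (c \o eta : R^o -> 'rV[R]_n) t ->
  atlas c -> atlas d -> chart_dom c (eta t) -> chart_dom d (eta t) ->
  'D_1 (d \o eta : R^o -> 'rV[R]_n) t =
    'D_1 (c \o eta : R^o -> 'rV[R]_n) t *m 'J (d \o chart_inv c) (c (eta t)).
Proof.
move=> ceta deta ac ad cx dx.
rewrite -(derive_comp_curve deta (transition_differentiable ac ad cx dx)).
apply: near_eq_derive.
have H : \forall s \near t, chart_dom c (eta s) := ceta _ (chart_near_dom ac cx).
by apply: filterS H => s cs /=; rewrite chart_invK.
Qed.

Lemma velocityE c eta t : velocity c eta t = 'D_1 (c \o eta : R^o -> 'rV[R]_n) t.
Proof. exact: derive1E. Qed.

Lemma velocity_transition c d eta t :
  smooth_curve eta -> atlas c -> atlas d -> chart_dom c (eta t) -> chart_dom d (eta t) ->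
  velocity d eta t = velocity c eta t *m 'J (d \o chart_inv c) (c (eta t)).
Proof.
move=> [ceta seta] ac ad cx dx; rewrite !velocityE.
exact: derive_transition (ceta t) (smooth_differentiable (seta c t ac cx)) ac ad cx dx.
Qed.

Lemma velocity_periodic c eta t (k : int) : (forall s, eta (s + 1) = eta s) ->
  velocity c eta (t + k%:~R) = velocity c eta t.
Proof.
move=> eta1.
have etak := periodicz eta1 k.
rewrite /velocity /derive1 /=.
suff -> : (fun h : R => h^-1 *: (c (eta (h + (t + k%:~R))) - c (eta (t + k%:~R)))) =
    (fun h => h^-1 *: (c (eta (h + t)) - c (eta t))) by [].
by apply/funext => h; rewrite addrA !etak.
Qed.

End Velocities.

Section Frames.
Context {R : realType} {F : oriented_manifold R 2}.
Implicit Types (eta : R -> F).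

Definition frame_det (c : @chart R 2 F) eta s t : R :=
  \det (col_mx (velocity c eta s) (velocity c eta t) : 'M[R]_2).

Lemma frame_det_swap c eta s t : frame_det c eta s t = - frame_det c eta t s.
Proof.
rewrite /frame_det; move: (velocity _ _ s) (velocity _ _ t) => v w.
by rewrite !det_mx2E; ring.
Qed.

Lemma frame_det_transition c d eta s t :
  smooth_curve eta -> eta s = eta t -> atlas c -> atlas d ->
  chart_dom c (eta s) -> chart_dom d (eta s) ->
  frame_det d eta s t = frame_det c eta s t * \det ('J (d \o chart_inv c) (c (eta s))).
Proof.
move=> se st ac ad cx dx; rewrite /frame_det.
rewrite (velocity_transition (t := s) se ac ad) // (velocity_transition (t := t) se ac ad) -?st //.
by rewrite -mul_col_mx det_mulmx.
Qed.

(** Exchanging the two vectors changes the sign of the determinant, while a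
    change of charts of the oriented atlas preserves it. *)
Lemma positive_frame_excl eta s t : smooth_curve eta -> eta s = eta t ->
  positive_frame eta s t -> ~ positive_frame eta t s.
Proof.
move=> se st [c [ac cx pc]] [d [ad dx pd]]; rewrite -st in dx.
move: pd; rewrite -/(frame_det d eta t s) frame_det_swap.
rewrite (frame_det_transition se st ac ad cx dx) oppr_gt0.
by rewrite lt_gtF // mulr_gt0 // transition_det.
Qed.

Lemma transverse_frame eta s t : eta s = eta t -> transverse_at eta s t ->
  positive_frame eta s t \/ positive_frame eta t s.
Proof.
move=> st tr; have [c ac cx] := atlas_cover (eta s).
have := tr c ac cx; rewrite row_free_unit unitmxE unitfE.
rewrite -/(frame_det c eta s t) neq_lt => /orP[lt0|gt0]; [right|left]; exists c; split => //.
  by rewrite -st.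
by rewrite -/(frame_det c eta t s) frame_det_swap oppr_gt0.
Qed.

Lemma positive_frame_periodic eta s t (j k : int) : (forall s, eta (s + 1) = eta s) ->
  eta (s + j%:~R) = eta s -> 
  positive_frame eta s t -> positive_frame eta (s + j%:~R) (t + k%:~R).
Proof.
move=> eta1 es [c [ac cs p]]; exists c; split; [exact: ac | by rewrite es |].
by rewrite (velocity_periodic c s j eta1) (velocity_periodic c t k eta1).
Qed.
End Frames.

(** * Orientations of local trivializations *)

(** The matrix M with M B = B' satisfies M (S, 0) = (1, 0), hence is block
    triangular; its lower right entry is the ratio [lam]. *)
Lemma row_ratio (K : fieldType) (n : nat) (B B' : 'M[K]_(n + 1)) (Q : 'M[K]_(n + 1, n))
   (S : 'M[K]_n)
   (e := row_mx 0 1%:M : 'rV[K]_(n + 1)) :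
  B' *m Q = col_mx 1%:M 0 -> B *m Q = col_mx S 0 ->
  B \in unitmx -> S \in unitmx ->
  exists lam, e *m B' = lam *: (e *m B) /\ \det B' * \det S = lam * \det B.
Proof.
move=> hB' hB uB uS; pose M := B' *m invmx B.
have MB : M *m B = B' by rewrite mulmxKV.
have MS : M *m col_mx S 0 = col_mx 1%:M 0.
  by rewrite -hB -hB' !mulmxA MB.
move: MS; rewrite -[M]submxK mul_block_col !mulmx0 !addr0 => /eq_col_mx[AS CS].
have C0 : dlsubmx M = 0 by rewrite -(mulmxK uS (dlsubmx M)) CS mul0mx.
exists (drsubmx M 0 0); split.
  rewrite -MB -[M in LHS]submxK mulmxA /e mul_row_block C0 !mul0mx !mulmx0 !add0r mul1mx.
  rewrite scalemxAl scale_row_mx scaler0; congr (row_mx _ _ *m _).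
  by rewrite [LHS]mx11_scalar scalemx1.
rewrite -MB det_mulmx -[M in \det M]submxK C0 det_ublock det_mx11.
have : \det (ulsubmx M) * \det S = 1 by rewrite -det_mulmx AS det1.
set a := \det _; set s := \det S => as1.
have -> : a * drsubmx M 0 0 * \det B * s = (a * s) * (drsubmx M 0 0 * \det B) by ring.
by rewrite as1 mul1r.
Qed.

Section TrivializationCoordinates.
Context {R : realType} {N : oriented_manifold R 3} {F : oriented_manifold R 2}.
Variable pi : circle_fibration N F.
Implicit Types (tau : trivialization N F) (c : @chart R 2 F) (d : @chart R 3 N).

Lemma triv_pt_continuous c x t : atlas c -> chart_dom c x ->
  {for (x, t), continuous (fun q : F * R => triv_pt c q.1 q.2)}.
Proof.
move=> ac cx; apply: mx_continuous => i j; rewrite /triv_pt (ord1 i).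
case: (@split_ordP 2 1 j) => k ->.
  rewrite [X in {for _, continuous X}](_ : _ = fun q : F * R => c q.1 0 k); last first.
    by apply/funext => q; exact: row_mxEl.
  apply: (@continuous_comp _ _ _ fst (fun y => c y 0 k)); first exact: cvg_fst.
  apply: (@continuous_comp _ _ _ c (fun y : 'rV[R]_2 => y 0 k)).
    exact: chart_continuous.
  exact: coord_continuous.
rewrite [X in {for _, continuous X}](_ : _ = fun q : F * R => q.2); last first.
  by apply/funext => q; rewrite [LHS]row_mxEr (ord1 k) mxE eqxx.
exact: cvg_snd.
Qed.

Section At.
Variables (tau : trivialization N F) (c : @chart R 2 F) (d : @chart R 3 N) (x : F) (t : R).
Hypothesis tau_triv : is_trivialization pi tau.
Hypothesis x_tau : triv_base tau x.
Hypotheses (c_at : atlas c) (d_at : atlas d).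
Hypotheses (x_c : chart_dom c x) (y_d : chart_dom d (triv_map tau x t)).

Lemma triv_coordE : triv_coord tau c d (triv_pt c x t) = d (triv_map tau x t).
Proof. by rewrite /triv_coord /triv_pt row_mxKl row_mxKr chart_invK // mxE eqxx. Qed.

Lemma triv_coord_near : \forall w \near triv_pt c x t,
  [/\ triv_base tau (chart_inv c (lsubmx (w : 'rV_(2 + 1)))),
      c (chart_inv c (lsubmx (w : 'rV_(2 + 1)))) = lsubmx (w : 'rV_(2 + 1)) &
      chart_dom d (triv_map tau (chart_inv c (lsubmx (w : 'rV_(2 + 1))))
                     (rsubmx (w : 'rV_(2 + 1)) 0 0))].
Proof.
have [otau _ _ ctau _] := tau_triv.
pose l (w : 'rV[R]_(2 + 1)) := chart_inv c (lsubmx w).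
have lE : l (triv_pt c x t) = x by rewrite /l row_mxKl chart_invK.
have cls : {for triv_pt c x t, continuous (fun w : 'rV[R]_(2 + 1) => lsubmx w)}.
  exact: continuous_lsubmx.
have cl : {for triv_pt c x t, continuous l}.
  apply: (@continuous_comp _ _ _ (fun w : 'rV[R]_(2 + 1) => lsubmx w)) cls _.
  by rewrite row_mxKl; exact: chart_inv_continuous.
have cr : {for triv_pt c x t, continuous (fun w : 'rV[R]_(2 + 1) => rsubmx w 0 0)}.
  apply: (@continuous_comp _ _ _ (fun w : 'rV[R]_(2 + 1) => rsubmx w) (fun v => v 0 0)).
    exact: continuous_rsubmx.
  exact: coord_continuous.
have n1 : \forall w \near triv_pt c x t, triv_base tau (l w).
  by apply: cl; rewrite lE; exact: open_nbhs_nbhs.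
have n2 : \forall w \near triv_pt c x t, c (l w) = lsubmx (w : 'rV_(2 + 1)).
  suff : \forall y \near lsubmx (triv_pt c x t : 'rV_(2 + 1)), c (chart_inv c y) = y.
    by move=> H; exact: cls _ H.
  by rewrite row_mxKl; apply: filterS (chart_near_image c_at x_c) => y [].
have n3 : \forall w \near triv_pt c x t,
    chart_dom d (triv_map tau (l w) (rsubmx (w : 'rV_(2 + 1)) 0 0)).
  have cc : {for triv_pt c x t, continuous (fun w : 'rV[R]_(2 + 1) =>
      triv_map tau (l w) (rsubmx w 0 0))}.
    apply: (@continuous_comp _ _ _ (fun w : 'rV[R]_(2 + 1) => (l w, rsubmx w 0 0))
        (fun q => triv_map tau q.1 q.2)); first exact: continuous_pair.
    by rewrite /= lE row_mxKr mxE eqxx; exact: ctau.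
  apply: cc => /=; rewrite lE row_mxKr mxE eqxx.
  exact: chart_near_dom.
by near=> w; split; near: w.
Unshelve. all: by end_near. Qed.
End At.
End TrivializationCoordinates.

Lemma jacobian_lsubmx (R : realType) m n (w : 'rV[R]_(m + n)) :
  'J (lsubmx : 'rV[R]_(m + n) -> 'rV[R]_m) w = col_mx 1%:M 0.
Proof.
apply/row_matrixP => i; rewrite [LHS]rowE [RHS]rowE /jacobian mul_rV_lin1.
rewrite (diff_lin _ (@continuous_lsubmx R 1 m n)) -[in RHS](hsubmxK (delta_mx 0 i)).
by rewrite mul_row_col mulmx1 mulmx0 addr0.
Qed.

Section TrivializationJacobians.
Context {R : realType} {N : oriented_manifold R 3} {F : oriented_manifold R 2}.
Variable pi : circle_fibration N F.
Implicit Types (tau : trivialization N F) (c : @chart R 2 F) (d : @chart R 3 N).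

Definition proj_coord c d : 'rV[R]_3 -> 'rV[R]_2 := c \o pi \o chart_inv d.

Lemma proj_coord_differentiable c d p : atlas c -> atlas d -> chart_dom d p ->
  chart_dom c (pi p) -> differentiable (proj_coord c d) (d p).
Proof.
move=> ac ad dp cp; apply: smooth_differentiable.
by case: (proj_smooth pi) => _ h; exact: h.
Qed.

Lemma jacobian_proj_transition c c' d d' p :
  atlas c -> atlas c' -> atlas d -> atlas d' ->
  chart_dom d p -> chart_dom d' p -> chart_dom c (pi p) -> chart_dom c' (pi p) ->
  'J (d' \o chart_inv d) (d p) *m 'J (proj_coord c' d') (d' p) =
  'J (proj_coord c d) (d p) *m 'J (c' \o chart_inv c) (c (pi p)).
Proof.
move=> ac ac' ad ad' dp d'p cp c'p.
have dT := transition_differentiable ad ad' dp d'p.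
have dS := transition_differentiable ac ac' cp c'p.
have dP := proj_coord_differentiable ac ad dp cp.
have dP' := proj_coord_differentiable ac' ad' d'p c'p.
have e1 : (d' \o chart_inv d) (d p) = d' p by rewrite /= chart_invK.
have e2 : proj_coord c d (d p) = c (pi p) by rewrite /proj_coord /= chart_invK.
rewrite -e1 in dP' *; rewrite -e2 in dS *.
rewrite -(jacobian_comp dT dP') -(jacobian_comp dP dS).
apply: near_eq_jacobian; [exact: differentiable_comp | exact: differentiable_comp |].
have cd : {for d p, continuous (chart_inv d)} := chart_inv_continuous ad dp.
have n1 : \forall w \near d p, chart_dom d' (chart_inv d w).
  by apply: cd; rewrite /= chart_invK //; exact: chart_near_dom.
have n2 : \forall w \near d p, chart_dom c (pi (chart_inv d w)).
  have cpi : {for d p, continuous (pi \o chart_inv d)}.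
    apply: continuous_comp cd _; exact: (proj_smooth pi).1.
  by apply: cpi; rewrite /= chart_invK //; exact: chart_near_dom.
near=> w; rewrite /proj_coord /= chart_invK ?chart_invK //; near: w; by [].
Unshelve. all: by end_near. Qed.

(** In coordinates, a trivialization followed by the projection of the fibration
    is the projection onto the first factor. *)
Lemma jacobian_triv_proj tau c d x t :
  is_trivialization pi tau -> triv_base tau x -> atlas c -> atlas d ->
  chart_dom c x -> chart_dom d (triv_map tau x t) ->
  ('J (triv_coord tau c d) (triv_pt c x t) *m
    'J (proj_coord c d) (d (triv_map tau x t)) : 'M_(2 + 1, 2)) = col_mx 1%:M 0.
Proof.
move=> ht bx ac ad cx dy.
have [_ hp _ _ /(_ c d x t ac ad bx cx dy)[/smooth_differentiable dA _]] := ht.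
have pE : pi (triv_map tau x t) = x by case: (hp x t bx).
have dP : differentiable (proj_coord c d) (triv_coord tau c d (triv_pt c x t)).
  by rewrite triv_coordE //; apply: proj_coord_differentiable => //; rewrite pE.
rewrite -(triv_coordE tau d t ac cx).
rewrite -(jacobian_comp dA dP) -(jacobian_lsubmx (triv_pt c x t : 'rV_(2 + 1))).
apply: near_eq_jacobian; [exact: differentiable_comp | exact: differentiable_lsubmx |].
apply: filterS (triv_coord_near ht bx ac ad cx dy) => w [bw cw dw].
rewrite /proj_coord /triv_coord /= chart_invK //.
by case: (hp _ (rsubmx (w : 'rV_(2 + 1)) 0 0) bw) => _ ->.
Qed.
End TrivializationJacobians.

(** Here [A] and [B] are the Jacobian matrices of two trivializations, [T] and [S]
    those of the changes of charts of the total space and of the base, [P] and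
    [Q] those of the projection.  [B] is the product
    of [A T] by a block triangular matrix, with diagonal blocks the inverse of S
    and, in the direction of the fiber, [lam]. *)
Lemma fiber_row_ratio (K : realFieldType) n (A T B : 'M[K]_(n + 1))
    (P Q : 'M_(n + 1, n)) (S : 'M_n) (e := row_mx 0 1%:M : 'rV_(n + 1)) :
  A *m P = col_mx 1%:M 0 -> B *m Q = col_mx 1%:M 0 -> T *m Q = P *m S ->
  \det A != 0 -> 0 < \det T -> 0 < \det S ->
  e *m (A *m T) != 0 /\ exists lam, e *m B = lam *: (e *m (A *m T)) /\
    Num.sg (\det B) = Num.sg lam * Num.sg (\det A).
Proof.
move=> AP BQ TQ detA detT detS.
have ATQ : A *m T *m Q = col_mx S 0.
  by rewrite -mulmxA TQ mulmxA AP mul_col_mx mul1mx mul0mx.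
have uAT : A *m T \in unitmx.
  by rewrite unitmx_mul !unitmxE !unitfE detA gt_eqF.
have uS : S \in unitmx by rewrite unitmxE unitfE gt_eqF.
have [lam [e1 e2]] := row_ratio BQ ATQ uAT uS.
split.
  apply/eqP => v0; have : e = 0 by rewrite -(mulmxK uAT e) v0 mul0mx.
  move/rowP/(_ (rshift n (0 : 'I_1))); rewrite [LHS]row_mxEr !mxE eqxx.
  by move/eqP; rewrite oner_eq0.
exists lam; split => //.
have := congr1 Num.sg e2; rewrite det_mulmx !sgrM (gtr0_sg detT) (gtr0_sg detS).
by rewrite !mulr1.
Qed.

Section TrivializationComparison.
Context {R : realType} {N : oriented_manifold R 3} {F : oriented_manifold R 2}.
Variable pi : circle_fibration N F.
Implicit Types (tau : trivialization N F) (c : @chart R 2 F) (d : @chart R 3 N).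

(** The direction of the second factor in the product of the base and the
    circle. *)
Definition fiber_dir : 'rV[R]_3 := row_mx (0 : 'rV_2) (1%:M : 'M_1).

Lemma triv_pt_derive c x t :
  differentiable (fun s : R^o => triv_pt c x s) t /\
  'D_1 (fun s : R^o => triv_pt c x s) t = fiber_dir.
Proof.
have E : (fun s : R^o => triv_pt c x s) = cst (triv_pt c x 0) + (fun s : R^o => (s : R) *: fiber_dir).
  apply/funext => s; rewrite /cst fctE /triv_pt /fiber_dir.
  apply/rowP => j; rewrite [RHS]mxE [X in _ + X]mxE.
  case: (@split_ordP 2 1 j) => k ->.
    by rewrite !(@row_mxEl _ _ 2 1) mxE mulr0 addr0.
  by rewrite !(@row_mxEr _ _ 2 1) (ord1 k) !mxE eqxx add0r mulr1.
have dl : differentiable (fun s : R^o => (s : R) *: fiber_dir) t.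
  exact: (@differentiableZl R _ _ id).
rewrite E; split; first exact: differentiableD.
rewrite deriveD; [|exact: derivable_cst|exact: diff_derivable].
rewrite derive_cst add0r deriveE //.
have -> : 'd (fun s : R^o => (s : R) *: fiber_dir) t = (fun z => 'd (id : R^o -> R^o) t z *: fiber_dir) :> (_ -> _).
  exact: (@diffZl R _ _ id).
by rewrite diff_val scale1r.
Qed.

Lemma fiber_curve_derive tau c d x t :
  is_trivialization pi tau -> triv_base tau x -> atlas c -> atlas d ->
  chart_dom c x -> chart_dom d (triv_map tau x t) ->
  differentiable (d \o triv_map tau x : R^o -> 'rV[R]_3) t /\
  'D_1 (d \o triv_map tau x : R^o -> 'rV[R]_3) t =
    fiber_dir *m 'J (triv_coord tau c d) (triv_pt c x t).
Proof.
move=> ht bx ac ad cx dy.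
have [_ _ _ _ /(_ c d x t ac ad bx cx dy)[/smooth_differentiable dA _]] := ht.
have [dg gE] := triv_pt_derive c x t.
have -> : (d \o triv_map tau x : R^o -> 'rV[R]_3) =
    triv_coord tau c d \o (fun s : R^o => triv_pt c x s).
  by apply/funext => s; rewrite /= triv_coordE.
split; first exact: differentiable_comp.
by rewrite (derive_comp_curve dg dA) gE.
Qed.

Definition triv_det tau c d x t : R := \det ('J (triv_coord tau c d) (triv_pt c x t)).

Lemma triv_det_neq0 tau c d x t :
  is_trivialization pi tau -> triv_base tau x -> atlas c -> atlas d ->
  chart_dom c x -> chart_dom d (triv_map tau x t) -> triv_det tau c d x t != 0.
Proof. by move=> [_ _ _ _ h] bx ac ad cx dy; case: (h c d x t ac ad bx cx dy). Qed.

(** At a common point of two parametrized fibers, the velocities are proportional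
    and their ratio has the sign of the ratio of the Jacobian determinants.  The
    charts may differ, which also gives the independence of the sign of the
    determinant from the charts. *)
Lemma triv_compare tau tau' c c' d d' x u t :
  is_trivialization pi tau -> triv_base tau x ->
  is_trivialization pi tau' -> triv_base tau' x ->
  atlas c -> atlas c' -> atlas d -> atlas d' -> chart_dom c x -> chart_dom c' x ->
  chart_dom d (triv_map tau x u) -> chart_dom d' (triv_map tau' x t) ->
  triv_map tau x u = triv_map tau' x t ->
  let v := 'D_1 (d' \o triv_map tau x : R^o -> 'rV[R]_3) u in
  let v' := 'D_1 (d' \o triv_map tau' x : R^o -> 'rV[R]_3) t in
  v != 0 /\ exists lam, v' = lam *: v /\
    Num.sg (triv_det tau' c' d' x t) = Num.sg lam * Num.sg (triv_det tau c d x u).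
Proof.
move=> ht bx ht' bx' ac ac' ad ad' cx c'x dy d'y ut v v'.
have d'y' : chart_dom d' (triv_map tau x u) by rewrite ut.
have piu : pi (triv_map tau x u) = x by case: ht => _ /(_ x u bx)[].
have vE : v = fiber_dir *m ('J (triv_coord tau c d) (triv_pt c x u) *m
    'J (d' \o chart_inv d) (d (triv_map tau x u))).
  have [dc Dc] := fiber_curve_derive ht bx ac ad cx dy.
  have cu : {for u, continuous (triv_map tau x)}.
    case: ht => _ _ _ /(_ x u bx) ctau _.
    apply: (@continuous_comp _ _ _ (fun s => (x, s)) (fun q => triv_map tau q.1 q.2)) => //.
    by apply: continuous_pair; [exact: cvg_cst | exact: cvg_id].
  apply: etrans (derive_transition cu dc ad ad' dy d'y') _.
  by rewrite Dc; exact/esym/mulmxA.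
have v'E : v' = fiber_dir *m 'J (triv_coord tau' c' d') (triv_pt c' x t).
  by case: (fiber_curve_derive ht' bx' ac' ad' c'x d'y).
have TP := @jacobian_proj_transition _ _ _ pi c c' d d' (triv_map tau x u) ac ac' ad ad' dy d'y'.
rewrite piu in TP; rewrite vE v'E.
apply: (fiber_row_ratio (jacobian_triv_proj ht bx ac ad cx dy)
  (jacobian_triv_proj ht' bx' ac' ad' c'x d'y)).
- by rewrite -ut; exact: TP.
- exact: (triv_det_neq0 ht).
- exact: transition_det.
- exact: (transition_det ac ac' cx c'x).
Qed.
End TrivializationComparison.

(** The points where f takes the value f x form an open and closed set. *)
Lemma connected_locally_constant (T : topologicalType) (U : Type) (f : T -> U)
    (A : set T) : connected A -> (forall x, \forall y \near x, f y = f x) ->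
  forall x y, A x -> A y -> f x = f y.
Proof.
move=> cA lf x y Ax Ay.
have oC (P : set U) : open (f @^-1` P).
  rewrite openE => z Pz; apply: filterS (lf z) => w /= fw.
  by rewrite /preimage /= fw.
have : A `&` f @^-1` [set f x] = A.
  apply: cA; first by exists x.
    by exists (f @^-1` [set f x]).
  exists (f @^-1` [set f x]) => //; rewrite -openC preimage_setC; exact: oC.
by move=> E; move: Ay; rewrite -E => -[_ /= ->].
Qed.

Lemma sg_near (R : realFieldType) (T : topologicalType) (f : T -> R) p :
  {for p, continuous f} -> f p != 0 -> \forall q \near p, Num.sg (f q) = Num.sg (f p).
Proof.
move=> cf; rewrite neq_lt => /orP[lt0|gt0].
  have nq : \forall q \near p, f q < 0 := cf _ (lt_nbhsl lt0).
  by apply: filterS nq => q ltq; rewrite !ltr0_sg.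
have nq : \forall q \near p, 0 < f q := cf _ (lt_nbhsr gt0).
by apply: filterS nq => q ltq; rewrite !gtr0_sg.
Qed.

(** The ratio of a nonzero vector to itself is 1. *)
Lemma scale_fixed_sg (K : realFieldType) (V : lmodType K) (v : V) (a b : K) :
  v != 0 /\ (exists lam, v = lam *: v /\ a = Num.sg lam * b) -> a = b.
Proof.
move=> [v0 [lam [vl ->]]]; suff -> : lam = 1 by rewrite sgr1 mul1r.
have /eqP : (lam - 1) *: v = 0 by rewrite scalerBl scale1r -vl subrr.
by rewrite scaler_eq0 (negbTE v0) orbF subr_eq0 => /eqP.
Qed.

Section TrivializationSign.
Context {R : realType} {N : oriented_manifold R 3} {F : oriented_manifold R 2}.
Variable pi : circle_fibration N F.
Implicit Types (tau : trivialization N F) (c : @chart R 2 F) (d : @chart R 3 N).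

(** The orientation character of a trivialization at a point; [fiber_sign] is the
    case of the trivialization chosen at x and of t = 0. *)
Definition triv_sg tau x t : R :=
  if `[< exists c d, [/\ atlas c, atlas d, chart_dom c x,
           chart_dom d (triv_map tau x t) & 0 < triv_det tau c d x t] >]
  then 1 else -1.

Section At.
Variable tau : trivialization N F.
Hypothesis ht : is_trivialization pi tau.

Lemma triv_sgE c d x t : triv_base tau x -> atlas c -> atlas d ->
  chart_dom c x -> chart_dom d (triv_map tau x t) ->
  triv_sg tau x t = Num.sg (triv_det tau c d x t).
Proof.
move=> bx ac ad cx dy.
have indep c' d' : atlas c' -> atlas d' -> chart_dom c' x ->
    chart_dom d' (triv_map tau x t) ->
    Num.sg (triv_det tau c' d' x t) = Num.sg (triv_det tau c d x t).
  move=> ac' ad' c'x d'y.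
  apply: scale_fixed_sg.
  exact: (triv_compare ht bx ht bx ac ac' ad ad' cx c'x dy d'y erefl).
rewrite /triv_sg; case: asboolP => [[c' [d' [ac' ad' c'x d'y]]]|no].
  by rewrite -(indep c' d') // => /gtr0_sg.
have := triv_det_neq0 ht bx ac ad cx dy.
rewrite neq_lt => /orP[/ltr0_sg -> //|gt0].
by case: no; exists c, d; split.
Qed.

Lemma triv_sg_near x t : triv_base tau x ->
  \forall q \near (x, t), triv_sg tau q.1 q.2 = triv_sg tau x t.
Proof.
move=> bx; have [c ac cx] := atlas_cover x.
have [d ad dy] := atlas_cover (triv_map tau x t).
have [otau _ _ ctau /(_ c d x t ac ad bx cx dy)[sA _]] := ht.
have cdet : {for (x, t), continuous (fun q : F * R => triv_det tau c d q.1 q.2)}.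
  apply: (@continuous_comp _ _ _ (fun q : F * R => triv_pt c q.1 q.2)
    (fun w => \det ('J (triv_coord tau c d) w))).
    exact: triv_pt_continuous.
  exact: det_jacobian_continuous.
have nsg : \forall q \near (x, t),
    Num.sg (triv_det tau c d q.1 q.2) = Num.sg (triv_det tau c d x t).
  exact: (sg_near cdet (triv_det_neq0 ht bx ac ad cx dy)).
have nb : \forall q \near (x, t), triv_base tau q.1.
  by apply: (@cvg_fst _ _ (nbhs x) (nbhs t)); exact: open_nbhs_nbhs.
have nc : \forall q \near (x, t), chart_dom c q.1.
  by apply: (@cvg_fst _ _ (nbhs x) (nbhs t)); exact: chart_near_dom.
have nd : \forall q \near (x, t), chart_dom d (triv_map tau q.1 q.2).
  by apply: (ctau x t bx) => /=; exact: chart_near_dom.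
have nbc := @filterI _ _ (nbhs_filter (x, t)) _ _ nb nc.
refine (@filterS3 _ _ (nbhs_filter (x, t)) _ _ _ _ _ nsg nbc nd) => q sq [bq cq] dq.
by rewrite (triv_sgE bx ac ad cx dy) (triv_sgE bq ac ad cq dq).
Qed.

(** The sign is locally constant along the fiber, which is parametrized by the
    connected line. *)
Lemma triv_sg_cst x t : triv_base tau x -> triv_sg tau x t = triv_sg tau x 0.
Proof.
move=> bx.
apply: (@connected_locally_constant R R (triv_sg tau x) setT) => //.
  by apply/connected_intervalP.
move=> s.
have cs : {for s, continuous (fun u : R => (x, u))}.
  by apply: continuous_pair; [exact: cvg_cst | exact: cvg_id].
exact: cs _ (triv_sg_near s bx).
Qed.

Lemma triv_sg_near0 x : triv_base tau x ->
  \forall y \near x, triv_sg tau y 0 = triv_sg tau x 0.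
Proof.
move=> bx.
have cs : {for x, continuous (fun y : F => (y, 0 : R))}.
  by apply: continuous_pair; [exact: cvg_id | exact: cvg_cst].
exact: cs _ (triv_sg_near 0 bx).
Qed.
End At.

Lemma fiber_signE x : fiber_sign pi x = triv_sg (triv_at pi x) x 0.
Proof. by []. Qed.

End TrivializationSign.

(** * Two parametrizations of a circle *)

Section CircleComparison.
Context {R : realType} {X : topologicalType}.
Hypothesis hX : hausdorff_space X.

Section Lift.
Variables (a g : continuousType R X).
Hypothesis a1 : forall t, a (t + 1) = a t.
Hypothesis a_inj : forall s t, a s = a t -> same_mod1 s t.
Hypothesis a_surj : forall t, exists u, a u = g t.

(** The compact set [a @` `[u + e, u + 1 - e]] misses [a u], so that points near
    [a u] have a parameter close to [u] modulo 1. *)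
Lemma lift_near t u (e : R) : a u = g t -> 0 < e <= 2^-1 ->
  \forall s \near t, exists v, a v = g s /\ `|v - u| < e.
Proof.
move=> aut /andP[e0 e12].
pose C := a @` `[u + e, u + 1 - e].
have cC : closed C.
  apply: compact_closed => //; apply: continuous_compact; last exact: segment_compact.
  by apply: continuous_subspaceT; exact: cts_fun.
have nC : ~ C (g t).
  move=> [v]; rewrite /= in_itv /= -aut => /andP[v1 v2] /a_inj vu.
  have E : v = u by apply: same_mod1_eq => //; lra.
  by move: v1; rewrite E; lra.
have nt : \forall s \near t, ~ C (g s).
  have gt : {for t, continuous g} by exact: cts_fun.
  have on : nbhs (g t) (~` C).
    by apply: open_nbhs_nbhs; split => //; exact: closed_openC.
  exact: gt _ on.
apply: filterS nt => s nCs.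
have [w aw] := a_surj s.
have [n wE wI] := next_afterP (u - e) w.
have aw' : a (next_after (u - e) w) = g s by rewrite wE (periodicz a1).
exists (next_after (u - e) w); split => //.
set w' := next_after (u - e) w in wE wI aw' *.
have : ~ (u + e <= w' <= u + 1 - e).
  by move=> h; apply: nCs; exists w'.
have : w' != u - e.
  apply/eqP => h; apply: nCs; exists (u + 1 - e); first by rewrite /= in_itv /=; lra.
  by rewrite -aw' h -[RHS]a1; congr (a _); lra.
move=> h1 /negP; rewrite ltr_norml; lra.
Qed.

(** Extended by u0 and u0 + 1, the lift h is continuous on [0, 1]: by [lift_near]
    a value g y close to g x has a parameter close to the value of the lift at x,
    and h y is the only candidate less than 1 apart.  Monotonicity is used at the
    ends, where u0 and u0 + 1 are parameters of the same point. *)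
Lemma increasing_lift u0 (h : R -> R) : a u0 = g 0 -> (forall t, g (t + 1) = g t) ->
  (forall t, 0 < t < 1 -> u0 < h t < u0 + 1 /\ a (h t) = g t) ->
  (forall s t, 0 < s < 1 -> 0 < t < 1 -> s < t -> h s < h t) ->
  cls (arc_chain g 0 1) = cls (arc_chain a 0 1) /\
  (forall d, 0 < d -> \forall s \near 0^'+, exists v, a v = g s /\ u0 < v < u0 + d).
Proof.
move=> au0 g1 hP hinc.
(* h is only known on the open interval. *)
pose H t := if t <= 0 then u0 else if 1 <= t then u0 + 1 else h t.
have aH t : 0 <= t <= 1 -> a (H t) = g t.
  move=> t01; rewrite /H; case: (lerP t 0) => t0.
    by have -> : t = 0 by lra.
  case: (lerP 1 t) => t1; last by case: (hP t); rewrite ?t0 ?t1.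
  have -> : t = 0 + 1 by lra.
  by rewrite g1 a1.
have [H0 H1] : H 0 = u0 /\ H 1 = u0 + 1.
  by rewrite /H !lexx ler10.
have HI t : u0 <= H t <= u0 + 1.
  rewrite /H; case: (lerP t 0) => t0; first by lra.
  case: (lerP 1 t) => t1; first by lra.
  by case: (hP t); [rewrite t0 t1 | lra].
have half : 0 < (2^-1 : R) < 1 by lra.
pose m := h 2^-1; have mI : u0 < m < u0 + 1 by case: (hP _ half).
have mE : m = h 2^-1 by [].
clearbody m.
have Hlt t : t < 2^-1 -> H t < m.
  move=> t2; rewrite /H; case: (lerP t 0) => t0; first by lra.
  by case: (lerP 1 t) => t1; [lra | rewrite mE; apply: hinc; lra].
have Hgt t : 2^-1 < t -> m < H t.
  move=> t2; rewrite /H; case: (lerP t 0) => t0; first by lra.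
  by case: (lerP 1 t) => t1; [lra | rewrite mE; apply: hinc; lra].
have key (x : R) : 0 <= x <= 1 -> exists2 e0 : R, 0 < e0 & \forall y \near x,
    forall v, a v = g y -> 0 <= y <= 1 -> `|v - H x| < e0 -> v = H y.
  move=> x01.
  have fin v y : a v = g y -> 0 <= y <= 1 -> -1 < v - H y < 1 -> v = H y.
    by move=> av y01; apply: same_mod1_eq; apply: a_inj; rewrite aH.
  have [x0|x0] := lerP x 0.
    have -> : x = 0 by lra.
    exists (u0 + 1 - m); first lra.
    have ny : \forall y \near (0 : R), y < 2^-1 by apply: lt_nbhsl; lra.
    apply: filterS ny => y /Hlt y2 v av y01 vx; apply: fin => //.
    move: vx; rewrite H0 ltr_norml; have := HI y; lra.
  have [x1|x1] := lerP 1 x.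
    have -> : x = 1 by lra.
    exists (m - u0); first lra.
    have ny : \forall y \near (1 : R), 2^-1 < y by apply: lt_nbhsr; lra.
    apply: filterS ny => y /Hgt y2 v av y01 vx; apply: fin => //.
    move: vx; rewrite H1 ltr_norml; have := HI y; lra.
  have [hx _] : u0 < h x < u0 + 1 /\ a (h x) = g x by apply: hP; rewrite x0 x1.
  have Hx : H x = h x by rewrite /H leNgt x0 leNgt x1.
  exists (Num.min (h x - u0) (u0 + 1 - h x)); first by rewrite lt_min; lra.
  have ny : \forall y \near x, y < 1 by exact: lt_nbhsl.
  apply: filterS ny => y _ v av y01 vx; apply: fin => //.
  move: vx; rewrite Hx lt_min !ltr_norml; have := HI y; lra.
have cH : {within `[0, 1], continuous H}.
  apply/subspace_continuousP => x; rewrite /= in_itv /= => x01.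
  apply/cvgrPdist_lt => e e0; rewrite near_withinE.
  have [e1 e10 nk] := key x x01.
  pose e2 := Num.min e (Num.min e1 2^-1).
  have e2P : 0 < e2 <= 2^-1 by rewrite /e2 !lt_min !ge_min lexx e0 e10 !orbT /=; lra.
  have nl := lift_near (aH x x01) e2P.
  apply: filterS2 nl nk => y [v [av ve]] hy; rewrite /= in_itv /= => y01.
  move: ve; rewrite /e2 !lt_min => /andP[ve /andP[ve1 _]].
  by move: ve; rewrite (hy v av y01 ve1) distrC.
split.
  by rewrite (cls_reparam cH (fun r r01 => esym (aH r r01))) H0 H1 (cls_loop a1).
move=> d d0.
have /subspace_continuousP/(_ 0) := cH; rewrite /= in_itv /= lexx ler01 => /(_ isT).
move=> /cvgrPdist_lt/(_ d d0); rewrite !near_withinE => nH.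
have n1 : \forall y \near (0 : R), y < 1 by exact: lt_nbhsl.
apply: filterS2 nH n1 => y hy y1 y0.
have y01 : 0 <= y <= 1 by rewrite !ltW.
exists (H y); split; first exact: aH.
have hI : u0 < H y by rewrite /H leNgt y0 leNgt y1 /=; case: (hP y) => [|/andP[]//]; rewrite y0.
have hd : `|H 0 - H y| < d by apply: hy; rewrite /= in_itv.
by move: hd; rewrite H0 ltr_norml; lra.
Qed.
End Lift.
End CircleComparison.

Section CircleReparametrization.
Context {R : realType} {X : topologicalType}.
Hypothesis hX : hausdorff_space X.
Variables (a g : continuousType R X).
Hypothesis a1 : forall t, a (t + 1) = a t.
Hypothesis g1 : forall t, g (t + 1) = g t.
Hypothesis a_inj : forall s t, a s = a t -> same_mod1 s t.
Hypothesis g_inj : forall s t, g s = g t -> same_mod1 s t.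
Hypothesis a_surj : forall t, exists u, a u = g t.

(** For 0 < t < 1 the point g t differs from g 0 = a u0, so it has exactly one
    parameter h t in the open interval from u0 to u0 + 1.  The map h is continuous
    and injective, hence monotone.  If it decreases, the increasing case applies
    to - h and to the reversed parametrization. *)
Lemma circle_compare u0 : a u0 = g 0 -> exists b : bool,
  cls (arc_chain g 0 1) = (if b then cls (arc_chain a 0 1) else - cls (arc_chain a 0 1)) /\
  forall d : R, 0 < d -> \forall s \near (0 : R)^'+, exists v, a v = g s /\
    if b then u0 < v < u0 + d else u0 - d < v < u0.
Proof.
move=> au0.
pose h t := next_after u0 (sval (cid (a_surj t))).
have ah t : a (h t) = g t.
  rewrite /h; case: cid => w aw /=; have [n -> _] := next_afterP u0 w.
  by rewrite (periodicz a1).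
have hI (t : R) : 0 < t < 1 -> u0 < h t < u0 + 1.
  move=> t01; have [n E] := next_afterP u0 (sval (cid (a_surj t))).
  rewrite -/(h t) le_eqVlt => /andP[/orP[/eqP u0h|-> -> //] _].
  have /same_mod1_eq t0 : same_mod1 t 0 by apply: g_inj; rewrite -ah -u0h.
  by have : t = 0 by [apply: t0; lra]; lra.
have uniq_h v (t : R) : 0 < t < 1 -> a v = g t -> u0 < v < u0 + 1 -> v = h t.
  move=> t01 av vI; have hIt := hI t t01; apply: same_mod1_eq; last by lra.
  by apply: a_inj; rewrite ah.
have ch : {within [set` `]0, 1[%R], continuous h}.
  rewrite continuous_open_subspace; last exact: interval_open.
  move=> t /set_mem; rewrite /= in_itv /= => t01; have hIt := hI t t01.
  apply/cvgrPdist_lt => e e0.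
  pose e2 := Num.min e (Num.min 2^-1 (Num.min (h t - u0) (u0 + 1 - h t))).
  have e2P : 0 < e2 <= 2^-1 by rewrite /e2 !lt_min !ge_min lexx e0 !orbT /=; lra.
  have nl := lift_near hX a1 a_inj a_surj (ah t) e2P.
  have n0 : \forall y \near t, 0 < y by apply: lt_nbhsr; lra.
  have n1 : \forall y \near t, y < 1 by apply: lt_nbhsl; lra.
  apply: filterS3 nl n0 n1 => y [v [av ve]] y0 y1.
  move: ve; rewrite /e2 !lt_min !ltr_norml => /and4P[ve _ v1 v2].
  have -> : h y = v by apply/esym/uniq_h => //; [rewrite y0 y1 | lra].
  by lra.
have injh : {in `]0, 1[%R &, injective h}.
  move=> s t; rewrite !in_itv /= => s01 t01 st; apply: same_mod1_eq; last by lra.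
  by apply: g_inj; rewrite -!ah st.
case: (itv_continuous_inj_mono ch injh) => hm.
  exists true; apply: (increasing_lift hX a1 a_inj a_surj (h := h)) => //.
  by move=> t t01; split; [exact: hI|exact: ah].
have oc : continuous (fun t : R => - t) by exact: opp_continuous.
pose a' : continuousType R X := a \o mkcts oc.
have a'E t : a' t = a (- t) by [].
have a'1 t : a' (t + 1) = a' t.
  by rewrite !a'E -[in LHS]a1; congr (a _); lra.
have a'_inj s t : a' s = a' t -> same_mod1 s t.
  by rewrite !a'E => /a_inj; rewrite /same_mod1 -opprD rpredN.
have a'_surj t : exists u, a' u = g t.
  by have [u au] := a_surj t; exists (- u); rewrite a'E opprK.
have a'u0 : a' (- u0 - 1) = g 0 by rewrite a'E -au0 -[RHS]a1; congr (a _); lra.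
have h'I (t : R) : 0 < t < 1 -> - u0 - 1 < - h t < - u0 - 1 + 1 /\ a' (- h t) = g t.
  by move=> t01; have := hI t t01; rewrite a'E opprK ah; split => //; lra.
have h'inc (s t : R) : 0 < s < 1 -> 0 < t < 1 -> s < t -> - h s < - h t.
  by move=> s01 t01 st; rewrite ltrN2; apply: hm; rewrite ?in_itv.
have [E nE] := increasing_lift hX a'1 a'_inj a'_surj a'u0 g1 h'I h'inc.
exists false; split.
  rewrite E.
  have -> : arc_chain a' 0 1 = arc_chain a 0 (- 1).
    by apply: eq_arc => u v _ _ _; rewrite a'E; congr (a _); lra.
  by rewrite cls_arcN -[in arc_chain a (-1) _](addNr 1) (cls_loop a1).
move=> d d0; apply: filterS (nE d d0) => s [v [av vI]].
exists (- v - 1); split; last by lra.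
by rewrite -a1 subrK -av.
Qed.
End CircleReparametrization.

Section Slopes.
Context {R : realType} {n : nat}.
Implicit Types (f k : R^o -> 'rV[R]_n).

(** For c = 1 or c = -1 this says that a coordinate with nonzero derivative
    increases or decreases strictly through u. *)
Lemma slope_near f (u c : R) j : differentiable f u -> 0 < c * 'D_1 f u 0 j ->
  exists2 d : R, 0 < d & forall h : R, h != 0 -> `|h| < d ->
    0 < c * (h^-1 * (f (h + u) 0 j - f u 0 j)).
Proof.
move=> df cD.
have /cvg_ex[l fl] : derivable f u (1 : R^o) by exact: diff_derivable.
have lE : 'D_1 f u = l by apply: cvg_lim fl; exact: norm_hausdorff.
rewrite lE in cD.
have cc : {for l, continuous (fun M : 'rV[R]_n => c * M 0 j)}.
  apply: (@continuous_comp _ _ _ (fun M : 'rV[R]_n => M 0 j) (fun x => c * x)).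
    exact: coord_continuous.
  exact: mulrl_continuous.
have nc : nbhs l [set M : 'rV[R]_n | 0 < c * M 0 j] := cc _ (lt_nbhsr cD).
have hw : \forall h \near (0 : R^o), h != 0 ->
  0 < c * (h^-1 *: ((f \o shift u) (h *: (1 : R^o)) - f u)) 0 j := fl _ nc.
have /nbhs_ballP[d /= d0 hd] := hw.
exists d => // h h0 hlt.
have := hd h; rewrite /ball /= sub0r normrN => /(_ hlt h0).
by rewrite !mxE [h%:A]mulr1.
Qed.

(** If the ratio had the wrong sign, then along a coordinate in which the velocity
    of f does not vanish, k would move at once to the side of f u opposite to the
    one where f takes its values. *)
Lemma direction_sign f k (u lam : R) (b : bool) :
  differentiable f u -> differentiable k 0 ->
  'D_1 f u != 0 -> 'D_1 k 0 = lam *: 'D_1 f u -> f u = k 0 ->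
  (forall d : R, 0 < d -> \forall s \near (0 : R)^'+, exists v, f v = k s /\
     if b then u < v < u + d else u - d < v < u) ->
  0 <= (-1) ^+ (~~ b) * lam.
Proof.
move=> df dk Df0 Dk fk H; set sg : R := (-1) ^+ (~~ b).
have [j fj] : exists j, 'D_1 f u 0 j != 0.
  apply: contrapT => h; case/eqP: Df0; apply/rowP => j; rewrite mxE.
  by apply: contrapT => /eqP hj; apply: h; exists j.
set D := 'D_1 f u 0 j in fj; have DD : 0 < D * D by rewrite -expr2 exprn_even_gt0.
rewrite leNgt; apply/negP => lam0.
have [d d0 hd] := slope_near df DD.
have DK : 0 < - (sg * D) * 'D_1 k 0 0 j.
  rewrite Dk mxE -/D; have -> : - (sg * D) * (lam * D) = (- (sg * lam)) * (D * D) by ring.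
  by rewrite mulr_gt0 // oppr_gt0.
have [e e0 he] := slope_near dk DK.
have nd := H d d0.
have : \forall s \near (0 : R)^'+, False.
  have n1 : \forall s \near (0 : R)^'+, s < e := nbhs_right_lt e0.
  have n2 : \forall s \near (0 : R)^'+, 0 < s := nbhs_right_gt 0.
  apply: filterS3 nd n1 n2 => s [v [fv vI]] se s0.
  have := he s (lt0r_neq0 s0); rewrite addr0 gtr0_norm // => /(_ se).
  have vu : 0 < sg * (v - u) by rewrite /sg; case: (b) vI => /=; rewrite ?expr0 ?expr1; lra.
  have vd : `|v - u| < d by case: (b) vI => vI; rewrite ltr_norml; lra.
  have vu0 : v - u != 0 by apply: contraTneq vu => ->; rewrite mulr0 ltxx.
  have := hd (v - u) vu0 vd; rewrite subrK fv -fk.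
  set w := k s 0 j - f u 0 j => h1 h2.
  have {h2} : 0 < - (sg * D) * w.
    by rewrite -(pmulr_rgt0 (x := s^-1)) ?invr_gt0 // mulrCA.
  suff : 0 < sg * D * w by lra.
  have -> : sg * D * w = sg * (v - u) * (D * ((v - u)^-1 * w)) by field.
  by rewrite mulr_gt0.
by move/filter_ex => [].
Qed.
End Slopes.

(** * Local constancy of the class of the fiber *)

(** With s and s' the signs of two trivializations, [lam] the ratio of the
    velocities and [b] the direction of the reparametrization. *)
Lemma sign_choice (K : realFieldType) (V : zmodType) (A : V) (b : bool) (s s' lam : K) :
  s = 1 \/ s = -1 -> s' = 1 \/ s' = -1 -> s' = Num.sg lam * s ->
  0 <= (-1) ^+ (~~ b) * lam ->
  (if b then A else - A) = (if s' == s then A else - A).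
Proof.
move=> sT sT' sE lam0; congr (if _ then _ else _).
have m11 : (-1 == 1 :> K) = false by apply/eqP; lra.
have lam_neq0 : lam != 0.
  apply/eqP => l0; move: sE; rewrite l0 sgr0 mul0r => s0.
  by case: sT'; rewrite s0; lra.
have -> : s' = (-1) ^+ (~~ b) * s.
  rewrite sE; congr (_ * _); move: lam0; case: (b) => /=.
    by rewrite expr0 mul1r le_eqVlt eq_sym (negbTE lam_neq0) => /gtr0_sg.
  rewrite expr1 mulN1r oppr_ge0 le_eqVlt (negbTE lam_neq0); exact: ltr0_sg.
case: sT => ->; case: (b); rewrite ?expr0 ?expr1 ?mulr1 ?mulrN1 ?opprK ?eqxx //.
by rewrite eq_sym m11.
Qed.

Section FiberClass.
Context {R : realType} {N : oriented_manifold R 3} {F : oriented_manifold R 2}.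
Variable pi : circle_fibration N F.
Implicit Types (tau : trivialization N F).

Lemma triv_map_continuous tau x : is_trivialization pi tau -> triv_base tau x ->
  continuous (triv_map tau x).
Proof.
move=> [_ _ _ h _] bx t.
apply: (@continuous_comp _ _ _ (fun s => (x, s)) (fun q => triv_map tau q.1 q.2)).
  by apply: continuous_pair; [exact: cvg_cst | exact: cvg_id].
exact: h.
Qed.

Definition triv_loop tau x (ht : is_trivialization pi tau) (bx : triv_base tau x) :
  continuousType R N := mkcts (triv_map_continuous ht bx).

Lemma cls_triv_loop tau tau' x (ht : is_trivialization pi tau) (bx : triv_base tau x)
    (ht' : is_trivialization pi tau') (bx' : triv_base tau' x) :
  cls (arc_chain (triv_loop ht' bx') 0 1) =
  if triv_sg tau' x 0 == triv_sg tau x 0 then cls (arc_chain (triv_loop ht bx) 0 1)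
  else - cls (arc_chain (triv_loop ht bx) 0 1).
Proof.
have per s (hs : is_trivialization pi s) (bs : triv_base s x) t :
    triv_loop hs bs (t + 1) = triv_loop hs bs t.
  exact: (triv_map_periodic 1 t hs bs).
have inj s (hs : is_trivialization pi s) (bs : triv_base s x) t u :
    triv_loop hs bs t = triv_loop hs bs u -> same_mod1 t u.
  by have [_ _ [_ h] _ _] := hs; exact: h.
have surj t : exists u, triv_loop ht bx u = triv_loop ht' bx' t.
  have piE : pi (triv_loop ht' bx' t) = x by have [_ /(_ x t bx')[]] := ht'.
  have [_ _ [h _] _ _] := ht; exists (triv_angle tau (triv_loop ht' bx' t)).
  by rewrite -[in RHS](h (triv_loop ht' bx' t)) piE.
have [u0 au0] := surj 0.
have [b [clE near0]] := circle_compare (@space_hausdorff _ _ N)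
  (per _ ht bx) (per _ ht' bx') (@inj _ ht bx) (@inj _ ht' bx') surj au0.
have [c ac cx] := atlas_cover x.
have [d ad dy] := atlas_cover (triv_map tau' x 0).
have dy0 : chart_dom d (triv_map tau x u0) by rewrite [triv_map _ _ _]au0.
have [v0 [lam [Dlam sgE]]] := triv_compare ht bx ht' bx' ac ac ad ad cx cx dy0 dy au0.
have [df _] := fiber_curve_derive ht bx ac ad cx dy0.
have [dk _] := fiber_curve_derive ht' bx' ac ad cx dy.
have {}sgE : triv_sg tau' x 0 = Num.sg lam * triv_sg tau x 0.
  have E := etrans (esym (triv_sgE ht bx ac ad cx dy0)) (triv_sg_cst ht u0 bx).
  exact: etrans (triv_sgE ht' bx' ac ad cx dy) (etrans sgE (congr1 _ E)).
have lam0 : 0 <= (-1) ^+ (~~ b) * lam.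
  apply: (direction_sign df dk v0 Dlam).
    by rewrite /= [triv_map _ _ u0]au0.
  move=> e e0; apply: filterS (near0 e e0) => s [v [av vI]].
  by exists v; split => //=; rewrite [triv_map _ _ v]av.
have sgT (s : trivialization N F) : triv_sg s x 0 = 1 \/ triv_sg s x 0 = -1.
  by rewrite /triv_sg; case: asboolP => _; [left|right].
apply: etrans clE _.
exact: (@sign_choice R (@chains_mod R N) (cls (arc_chain (triv_loop ht bx) 0 1)) b _ _ lam
  (sgT tau) (sgT tau') sgE lam0).
Qed.
End FiberClass.

Section FiberClassConstant.
Context {R : realType} {N : oriented_manifold R 3} {F : oriented_manifold R 2}.
Variable pi : circle_fibration N F.
Implicit Types (tau : trivialization N F) (x y : F).

Lemma cls_fiber tau x (ht : is_trivialization pi tau) (bx : triv_base tau x) :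
  cls (arc_chain (fiber pi x) 0 1) =
  if triv_sg tau x 0 == 1 then cls (arc_chain (triv_loop ht bx) 0 1)
  else - cls (arc_chain (triv_loop ht bx) 0 1).
Proof.
have [h0 b0] := triv_atP pi x.
set L := cls (arc_chain (triv_loop ht bx) 0 1).
have E0 := cls_triv_loop ht bx h0 b0; rewrite -/L in E0.
have per t : triv_loop h0 b0 (t + 1) = triv_loop h0 b0 t.
  exact: (triv_map_periodic 1 t h0 b0).
have sgE := fiber_signE pi x.
have sgT : triv_sg tau x 0 = 1 \/ triv_sg tau x 0 = -1.
  by rewrite /triv_sg; case: asboolP => _; [left|right].
have m11 : (-1 == 1 :> R) = false.
  by rewrite eq_sym -subr_eq0 opprK -(natrD R 1 1) pnatr_eq0.
have fE t : (fiber pi x : continuousType R N) t = triv_loop h0 b0 (fiber_sign pi x * t) by [].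
case: (fiber_sign_cases pi x) => s0.
  have -> : arc_chain (fiber pi x) 0 1 = arc_chain (triv_loop h0 b0) 0 1.
    by apply: eq_arc => u v _ _ _; rewrite fE s0 mul1r.
  rewrite E0 -sgE s0; case: sgT => ->; first by rewrite !eqxx.
  by rewrite eq_sym m11.
have -> : arc_chain (fiber pi x) 0 1 = arc_chain (triv_loop h0 b0) 0 (- 1).
  apply: eq_arc => u v _ _ _; rewrite fE s0.
  by congr (triv_loop h0 b0 _); ring.
rewrite cls_arcN -[in arc_chain _ (-1) _](addNr 1) (cls_loop per) E0 -sgE s0.
by case: sgT => ->; rewrite ?m11 ?eqxx ?opprK.
Qed.

(** A point near x is joined to x by a segment in a chart, and the fibers over
    that segment form a homotopy of loops. *)
Lemma cls_triv_loop_near tau x (ht : is_trivialization pi tau) (bx : triv_base tau x) :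
  \forall y \near x, forall by_ : triv_base tau y,
    cls (arc_chain (triv_loop ht by_) 0 1) = cls (arc_chain (triv_loop ht bx) 0 1).
Proof.
have [c ac cx] := atlas_cover x.
have [otau _ _ ctau _] := ht.
have cinv := chart_inv_continuous ac cx.
have nb : \forall z \near c x, triv_base tau (chart_inv c z).
  by apply: cinv; rewrite chart_invK //; exact: open_nbhs_nbhs.
have [e /= e0 he] := (nbhs_ballP _ _).1 (filterI (chart_near_image ac cx) nb).
have nc : \forall y \near x, ball (c x) e (c y).
  exact: (chart_continuous ac cx) _ (nbhsx_ballx _ _ e0).
apply: filterS2 nc (chart_near_dom ac cx) => y ye cy by_.
(* The segment from x to y in the chart; it stays in a ball on which the inverse
   of the chart is defined and takes its values in the base of tau. *)
pose z (r : R) : 'rV[R]_2 := c x + r *: (c y - c x).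
have zb r : 0 <= r <= 1 -> ball (c x) e (z r).
  move=> /andP[r0 r1]; move: ye; rewrite -ball_normE /ball_ /z /=.
  rewrite opprD addrA subrr add0r normrN normrZ ger0_norm // distrC => ye.
  by apply: le_lt_trans ye; rewrite ler_piMl.
have zP r : 0 <= r <= 1 -> [/\ chart_dom c (chart_inv c (z r)),
    c (chart_inv c (z r)) = z r & triv_base tau (chart_inv c (z r))].
  by move=> /zb/he[[? ?] ?].
pose G r t := triv_map tau (chart_inv c (z r)) t.
have z0 : z 0 = c x by rewrite /z scale0r addr0.
have z1 : z 1 = c y by rewrite /z scale1r addrC subrK.
have cz : continuous z.
  move=> r; apply: (@cvgD _ _ _ _ _ (cst (c x)) (fun r => r *: (c y - c x))).
    exact: cvg_cst.
  exact: scalel_continuous.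
apply: (@cls_free_homotopy _ _ G).
- apply/subspace_continuousP => -[r t] /= r01; apply: cvg_within_filter.
  have [dz ez bz] := zP r r01.
  apply: (@continuous_comp _ _ _ (fun q : R * R => (chart_inv c (z q.1), q.2))
    (fun q => triv_map tau q.1 q.2)); last exact: ctau.
  apply: continuous_pair; last exact: cvg_snd.
  apply: (@continuous_comp _ _ _ (fun q : R * R => z q.1) (chart_inv c)).
    by apply: (@continuous_comp _ _ _ fst z); [exact: cvg_fst | exact: cz].
  by rewrite /= -ez; exact: chart_inv_continuous.
- by move=> t; rewrite /G z0 chart_invK.
- by move=> t; rewrite /G z1 chart_invK.
- move=> r r01; have [_ _ bz] := zP r r01.
  by rewrite /G -[in RHS](add0r 1); exact/esym/(triv_map_periodic 1 0 ht bz).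
Qed.

(** The trivialization chosen at x serves for all nearby points, and both its
    class and its sign are constant near x. *)
Lemma fiber_class_near x : \forall y \near x, fiber_class pi y = fiber_class pi x.
Proof.
have [h0 b0] := triv_atP pi x; have [otau _ _ _ _] := h0.
have nb : \forall y \near x, triv_base (triv_at pi x) y by exact: open_nbhs_nbhs.
apply: filterS3 (cls_triv_loop_near h0 b0) (triv_sg_near0 h0 b0) nb => y yE ysg by_.
have cyc u : is_cycle (arc_chain (fiber pi u) 0 1).
  by apply: is_cycle_loop; rewrite -[in RHS](add0r 1); exact/esym/fiber_periodic.
apply: hclass_cls; [exact: cyc | exact: cyc |].
have Ey := cls_fiber h0 by_.
rewrite [triv_sg _ y 0]ysg [cls (arc_chain (triv_loop h0 by_) 0 1)]yE in Ey.
exact: etrans Ey (esym (cls_fiber h0 b0)).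
Qed.

Lemma fiber_class_component x y :
  connected_component [set: F] x y -> fiber_class pi x = fiber_class pi y.
Proof.
move=> [C [Cx _ cC] Cy].
exact: (connected_locally_constant cC fiber_class_near).
Qed.
End FiberClassConstant.

(** * Finiteness of the set of double points *)

(** Otherwise the sets whose complement in A is finite form a proper filter, and a
    cluster point of it contradicts the isolation. *)
Lemma compact_isolated_finite (T : topologicalType) (Q A : set T) :
  compact Q -> A `<=` Q -> (forall p, Q p -> \forall q \near p, A q -> q = p) ->
  finite_set A.
Proof.
move=> cQ AQ iso; apply: contrapT => infA.
(* The filter of the sets that are cofinite in A. *)
pose FF : set_system T := [set B | finite_set (A `\` B)].
have FP : ProperFilter FF.
  split; first by rewrite /FF /= setD0.
  split=> [|B C|B C BC].
  - by rewrite /FF /= setDT; exact: finite_set0.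
  - by rewrite /FF /= setDIr => fB fC; rewrite finite_setU.
  - by rewrite /FF /=; apply: sub_finite_set => x [Ax nC]; split => // /BC.
have FQ : FF Q.
  by rewrite /FF /= (_ : A `\` Q = set0) //; apply/seteqP; split => // x [/AQ].
have [p [Qp clp]] := cQ _ FP FQ.
have FB : FF (A `\ p).
  rewrite /FF /=; apply: (@sub_finite_set _ _ [set p]); last exact: finite_set1.
  by move=> x [Ax nx]; apply: contrapT => xp; apply: nx; split.
have [q [[Aq qp] hq]] := clp _ _ FB (iso p Qp).
exact/qp/hq.
Qed.

Section CurveCoordinates.
Context {R : realType} {n : nat}.
Implicit Types f : R^o -> 'rV[R]_n.

Lemma coord_linear_approx f (u e : R) : differentiable f u -> 0 < e ->
  exists2 d : R, 0 < d & forall h : R, `|h| < d ->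
    forall j, `|f (h + u) 0 j - f u 0 j - h * 'D_1 f u 0 j| <= e * `|h|.
Proof.
move=> df e0.
have /cvg_ex[l fl] : derivable f u (1 : R^o) by exact: diff_derivable.
have lE : 'D_1 f u = l by apply: cvg_lim fl; exact: norm_hausdorff.
have hw : \forall h \near (0 : R^o), h != 0 ->
   ball l e (h^-1 *: ((f \o shift u) (h *: (1 : R^o)) - f u)) := fl _ (nbhsx_ballx l e e0).
have [d /= d0 hd] := (nbhs_ballP _ _).1 hw.
exists d => // h hlt j; rewrite lE.
have [->|h0] := eqVneq h 0; first by rewrite add0r subrr mul0r subr0 normr0 mulr0.
have := hd h; rewrite /ball /= sub0r normrN => /(_ hlt h0) [_ /(_ 0 j)].
rewrite !mxE [h%:A]mulr1 /ball /= => hb.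
have -> : f (h + u) 0 j - f u 0 j - h * l 0 j = - h * (l 0 j - h^-1 * (f (h + u) 0 j - f u 0 j)).
  by field.
by rewrite normrM normrN mulrC ler_wpM2r // ltW.
Qed.

Lemma coord_is_derive f (u : R) j : differentiable f u ->
  is_derive u (1 : R) (fun s : R => f s 0 j) ('D_1 f u 0 j).
Proof.
move=> df; have dfv : derivable f u (1 : R^o) by exact: diff_derivable.
apply: DeriveDef; first by have /derivable_mxP/(_ 0 j) := dfv.
by rewrite (derive_mx dfv) mxE.
Qed.
End CurveCoordinates.

(** By Cramer's rule, h v - k w is bounded below by a multiple of |h| + |k| when v
    and w are independent. *)
Lemma cramer_isolated (K : realFieldType) (v0 v1 w0 w1 : K) : v0 * w1 - v1 * w0 != 0 ->
  exists2 e, 0 < e & forall h k, `|h * v0 - k * w0| <= e * (`|h| + `|k|) ->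
    `|h * v1 - k * w1| <= e * (`|h| + `|k|) -> h = 0 /\ k = 0.
Proof.
set D := _ - _ => D0.
pose S := `|v0| + `|v1| + `|w0| + `|w1|.
have S0 : 0 <= S by rewrite !addr_ge0.
have aD : 0 < `|D| by rewrite normr_gt0.
have S1 : 0 < 2 * (S + 1) by lra.
(* Adding 1 keeps the denominator positive; the factor 2 makes the estimate
   strict. *)
exists (`|D| / (2 * (S + 1))); first by rewrite divr_gt0.
move=> h k; set r0 := h * v0 - _; set r1 := h * v1 - _; set m := `|h| + `|k|; set e := _ / _.
move=> r0e r1e.
have e0 : 0 <= e by rewrite divr_ge0 // ltW.
have m0 : 0 <= m by rewrite addr_ge0.
have E1 : h * D = r0 * w1 - r1 * w0 by rewrite /D /r0 /r1; ring.
have E2 : k * D = r0 * v1 - r1 * v0 by rewrite /D /r0 /r1; ring.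
have B1 : `|h| * `|D| <= e * m * (`|w1| + `|w0|).
  rewrite -normrM E1 (le_trans (ler_normB _ _)) // !normrM mulrDr.
  by rewrite lerD // ler_wpM2r.
have B2 : `|k| * `|D| <= e * m * (`|v1| + `|v0|).
  rewrite -normrM E2 (le_trans (ler_normB _ _)) // !normrM mulrDr.
  by rewrite lerD // ler_wpM2r.
have B : m * `|D| <= e * m * S.
  have -> : m * `|D| = `|h| * `|D| + `|k| * `|D| by rewrite mulrDl.
  have -> : e * m * S = e * m * (`|w1| + `|w0|) + e * m * (`|v1| + `|v0|) by rewrite /S; ring.
  exact: lerD.
have eS : e * S <= `|D| / 2.
  rewrite /e; have -> : `|D| / (2 * (S + 1)) * S = `|D| / 2 * (S / (S + 1)) by field; lra.
  by rewrite ler_piMr ?divr_ge0 // ler_pdivrMr; lra.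
have m00 : m = 0.
  apply/eqP; rewrite eq_le m0 andbT leNgt; apply/negP => mgt.
  have : m * `|D| <= m * (`|D| / 2).
    by rewrite (le_trans B) // [e * m]mulrC -mulrA ler_wpM2l.
  by rewrite ler_pM2l //; lra.
move/eqP: m00; rewrite /m paddr_eq0 // !normr_eq0 => /andP[/eqP -> /eqP ->].
by [].
Qed.

Section IsolatedDoublePoints.
Context {R : realType} {F : oriented_manifold R 2}.
Implicit Types (eta : R -> F) (s t : R).

(** The neighborhoods of a pair are generated by products. *)
Lemma near_prod (P : R * R -> Prop) (A B : R -> Prop) s t :
  (\forall x \near s, A x) -> (\forall y \near t, B y) ->
  (forall x y, A x -> B y -> P (x, y)) -> \forall q \near (s, t), P q.
Proof. by move=> nA nB AB; exists (A, B) => // -[x y] [/= Ax By]; exact: AB. Qed.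

Lemma distinct_isolated eta s t : continuous eta -> eta s <> eta t ->
  \forall q \near (s, t), eta q.1 <> eta q.2.
Proof.
move=> ceta st.
have /eqP st' : eta s != eta t by apply/eqP.
have := @space_hausdorff _ _ F; rewrite open_hausdorff => /(_ (eta s) (eta t)).
case=> [|[A B] /= [As Bt] [oA oB AB]]; first exact/eqP.
have nA : \forall x \near s, A (eta x).
  by apply: (ceta s) => /=; apply: open_nbhs_nbhs; split => //; exact/set_mem.
have nB : \forall y \near t, B (eta y).
  by apply: (ceta t) => /=; apply: open_nbhs_nbhs; split => //; exact/set_mem.
apply: near_prod nA nB _ => x y /= Ax By xy.
have : (A `&` B) (eta x) by split => //; rewrite xy.
by move/eqP: AB => ->.
Qed.

(** Some coordinate of the curve has a nonvanishing derivative near s, so by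
    Rolle's theorem the curve is injective there.  The translation by n covers
    the pairs of parameters that are close modulo 1. *)
Lemma immersion_isolated eta s (n : int) : immersed_loop eta ->
  \forall q \near (s, s + n%:~R), eta q.1 = eta q.2 -> q.1 = q.2 - n%:~R.
Proof.
move=> [[ceta seta] eta1 veta].
have [c ac cs] := atlas_cover (eta s).
pose f : R^o -> 'rV[R]_2 := c \o eta.
have sf : smooth_at f s by exact: seta.
have := veta c s ac cs; rewrite velocityE -/f => v0.
have [j fj] : exists j, 'D_1 f s 0 j != 0.
  apply: contrapT => h; case/eqP: v0; apply/rowP => j; rewrite mxE.
  by apply: contrapT => /eqP hj; apply: h; exists j.
have cD : {for s, continuous (fun u => 'D_1 f u 0 j)}.
  apply: (@continuous_comp _ _ _ (fun u => 'D_1 f u) (fun M => M 0 j)).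
    exact: smooth_derive_continuous.
  exact: coord_continuous.
have nsg := sg_near cD fj.
have [e /= e0 he] := (nbhs_ballP _ _).1 (filterI (smooth_near_differentiable sf) nsg).
have {}he u : `|u - s| < e -> differentiable f u /\ 'D_1 f u 0 j != 0.
  move=> us; have : ball s e u by rewrite /ball /= distrC.
  move=> /he[du sgu]; split; first exact: du.
  by rewrite -sgr_eq0 sgu sgr_eq0.
have key (a b : R) : `|a - s| < e -> `|b - s| < e -> a < b -> eta a = eta b -> False.
  move=> ae be ab etaab.
  have inI u : u \in `[a, b] -> `|u - s| < e.
    by move: ae be; rewrite in_itv /= !ltr_norml; lra.
  have dF u : u \in `[a, b] -> is_derive u (1 : R) (fun x : R => f x 0 j) ('D_1 f u 0 j).
    by move=> /inI/he[du _]; exact: coord_is_derive.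
  have [|||w wI dw] := @Rolle R (fun x : R => f x 0 j) a b ab.
  - by move=> u uI; apply: ex_derive; apply: dF; apply: subset_itv_oo_cc.
  - by apply: derivable_within_continuous => u uI; apply: ex_derive; exact: dF.
  - by rewrite /f /= etaab.
  have wI' : w \in `[a, b] by exact: subset_itv_oo_cc.
  have [_ /eqP[]] := he w (inI w wI').
  exact: etrans (esym (@derive_val _ _ _ _ _ _ _ (dF w wI'))) (@derive_val _ _ _ _ _ _ _ dw).
have n1 : \forall x \near s, `|x - s| < e.
  by apply: filterS (nbhsx_ballx s e e0) => x; rewrite /ball /= distrC.
have n2 : \forall y \near s + n%:~R, `|y - n%:~R - s| < e.
  apply: filterS (nbhsx_ballx (s + n%:~R) e e0) => y; rewrite /ball /= distrC.
  by rewrite -addrA -opprD [n%:~R + s]addrC.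
apply: near_prod n1 n2 _ => x y /= xe ye xy.
have etay : eta (y - n%:~R) = eta y.
  by rewrite -(periodicz eta1 n (y - n%:~R)) subrK.
have [xlt|ylt|//] := ltgtP x (y - n%:~R).
  by case: (key _ _ xe ye xlt); rewrite etay.
by case: (key _ _ ye xe ylt); rewrite etay.
Qed.

(** If eta (s + h) = eta (t + k), then h v - k w is small compared with |h| + |k|,
    v and w being the two velocities. *)
Lemma transverse_isolated eta s t : immersed_loop eta -> eta s = eta t ->
  transverse_at eta s t -> \forall q \near (s, t), eta q.1 = eta q.2 -> q = (s, t).
Proof.
move=> [[ceta seta] eta1 _] st tr.
have [c ac cs] := atlas_cover (eta s).
have ct : chart_dom c (eta t) by rewrite -st.
pose f : R^o -> 'rV[R]_2 := c \o eta.
have df := smooth_differentiable (seta c s ac cs).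
have dg := smooth_differentiable (seta c t ac ct).
have := tr c ac cs; rewrite row_free_unit unitmxE unitfE !velocityE det_mx2E.
set v := 'D_1 _ s; set w := 'D_1 _ t => D0.
have [e e0 he] := cramer_isolated D0.
have [ds ds0 hs] := coord_linear_approx df e0.
have [dt dt0 ht] := coord_linear_approx dg e0.
have n1 : \forall x \near s, `|x - s| < ds.
  by apply: filterS (nbhsx_ballx s ds ds0) => x; rewrite /ball /= distrC.
have n2 : \forall y \near t, `|y - t| < dt.
  by apply: filterS (nbhsx_ballx t dt dt0) => y; rewrite /ball /= distrC.
apply: near_prod n1 n2 _ => x y /= xs yt xy.
have bound j : `|(x - s) * v 0 j - (y - t) * w 0 j| <= e * (`|x - s| + `|y - t|).
  have := hs _ xs j; have := ht _ yt j; rewrite !subrK /= -/v -/w -xy -st.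
  move: ((x - s) * v 0 j) ((y - t) * w 0 j) (c (eta x) 0 j) (c (eta s) 0 j).
  move=> a b p q h1 h2; have -> : a - b = (p - q - b) - (p - q - a) by ring.
  rewrite (le_trans (ler_normB _ _)) // mulrDr addrC; exact: lerD.
have [h k] := he (x - s) (y - t) (bound 0) (bound 1).
by congr (_, _); apply/eqP; rewrite -subr_eq0 ?h ?k.
Qed.
End IsolatedDoublePoints.

(** * Resolutions of singular points *)

Section Crossings.
Context {R : realType} {N : oriented_manifold R 3} {F : oriented_manifold R 2}.
Variable pi : circle_fibration N F.
Implicit Types (K : continuousType R N) (G : R -> continuousType R N).

Lemma double_points_finite K : generic_loop (pi \o K) -> finite_set (double_points pi K).
Proof.
move=> [im tr _]; have ceta : continuous (pi \o K) by case: im => [[]].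
have cQ : compact (`[0, 1]%classic `*` `[0, 1]%classic : set (R * R)).
  by apply: compact_setX; exact: segment_compact.
apply: (compact_isolated_finite cQ).
  move=> -[s t] [/= s01 t01 _ _ _]; rewrite /= !in_itv /=; lra.
move=> -[s t] _.
have [/same_mod1P[n sE]|nst] := pselect (same_mod1 s t).
  have ni := immersion_isolated s (- n) im; rewrite mulrNz in ni.
  have tE : t = s - n%:~R by rewrite sE addrK.
  rewrite tE; apply: (@filterS _ (nbhs (s, s - n%:~R)) (nbhs_filter _) _ _ _ ni).
  move=> -[x y] /= h [/= x01 y01 xy exy _]; case/eqP: xy.
  apply: same_mod1_eq; last by move: x01 y01; lra.
  by apply/same_mod1P; exists n; rewrite (h exy) opprK.
have [est|nest] := pselect (pi (K s) = pi (K t)).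
  have ni := transverse_isolated im est (tr s t nst est).
  apply: (@filterS _ (nbhs (s, t)) (nbhs_filter _) _ _ _ ni).
  by move=> -[x y] /= h [/= _ _ _ exy _]; exact: h.
have ni := distinct_isolated ceta nest.
apply: (@filterS _ (nbhs (s, t)) (nbhs_filter _) _ _ _ ni).
by move=> -[x y] /= h [/= _ _ _ exy _]; case: h.
Qed.

(** A locally constant function is constant along a curve. *)
Lemma fiber_class_curve (eta : R -> F) s t : continuous eta ->
  fiber_class pi (eta s) = fiber_class pi (eta t).
Proof.
move=> ceta.
apply: (@connected_locally_constant R _ (fiber_class pi \o eta) setT) => //.
  by apply/connected_intervalP.
by move=> u; exact: (ceta u) _ (fiber_class_near pi (eta u)).
Qed.

Lemma closed_arc_shift K a b (m n : int) : (forall t, K (t + 1) = K t) ->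
  closed_arc_class pi K (a + m%:~R) (b + n%:~R) = closed_arc_class pi K a b.
Proof.
move=> K1; rewrite /closed_arc_class next_after_shift (arc_shift K1).
by rewrite !(periodicz K1).
Qed.

Lemma loop_class_shift K a b (m n : int) : (forall t, K (t + 1) = K t) ->
  loop_class K (a + m%:~R) (b + n%:~R) = loop_class K a b.
Proof. by move=> K1; rewrite /loop_class next_after_shift (arc_shift K1). Qed.

Lemma closed_arc_cycle K a b : (forall t, K (t + 1) = K t) -> pi (K a) = pi (K b) ->
  is_cycle (arc_chain K a (next_after a b) + fiber_arc pi (K b) (K a)).
Proof.
move=> K1 ab; have [n nE _] := next_afterP a b.
apply: is_cycle_arc2.
  by rewrite nE (periodicz K1); exact/esym/fiber_angleK.
have [m mE _] := next_afterP (fiber_angle pi (K b)) (fiber_angle pi (K a)).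
rewrite mE; apply: etrans (periodicz (fiber_periodic pi _) m _) _.
by rewrite -ab; exact: fiber_angleK.
Qed.

Section Motion.
Variables (G : R -> continuousType R N) (K0 K : continuousType R N).
Hypothesis cG : {within [set q : R * R | 0 <= q.1 <= 1],
          continuous (fun q : R * R => G q.1 q.2)}.
Hypotheses (G0 : G 0 = K0) (G1 : G 1 = K).
Hypothesis Gper : forall r t, 0 <= r <= 1 -> G r (t + 1) = G r t.

Lemma knot_class_motion : knot_class K = knot_class K0.
Proof.
have r0 : 0 <= (0 : R) <= 1 by rewrite lexx ler01.
have r1 : 0 <= (1 : R) <= 1 by rewrite lexx ler01.
have cyc r : 0 <= r <= 1 -> is_cycle (arc_chain (G r) 0 1).
  by move=> r01; apply: is_cycle_loop; rewrite -[in RHS](add0r 1) Gper.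
rewrite /knot_class -G0 -G1; apply: hclass_cls; [exact: cyc | exact: cyc |].
apply: (@cls_free_homotopy _ _ G) => // r r01.
by rewrite -[in RHS](add0r 1) Gper.
Qed.

(** Both ends of the arc stay in place, so their traces are constant and the
    closing arc of fiber is the same. *)
Lemma closed_arc_fixed a b : pi (K0 a) = pi (K0 b) ->
  (forall r, 0 <= r <= 1 -> G r a = K0 a) -> (forall r, 0 <= r <= 1 -> G r b = K0 b) ->
  closed_arc_class pi K a b = closed_arc_class pi K0 a b.
Proof.
move=> piab Ga Gb.
have r0 : 0 <= (0 : R) <= 1 by rewrite lexx ler01.
have r1 : 0 <= (1 : R) <= 1 by rewrite lexx ler01.
have Ka : K a = K0 a by rewrite -G1 Ga.
have Kb : K b = K0 b by rewrite -G1 Gb.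
have K1 t : K (t + 1) = K t by rewrite -G1 Gper.
have K01 t : K0 (t + 1) = K0 t by rewrite -G0 Gper.
apply: hclass_cls; [by apply: closed_arc_cycle => //; rewrite Ka Kb | exact: closed_arc_cycle |].
rewrite Ka Kb !raddfD /=; congr (_ + _).
have [n nE _] := next_afterP a b.
pose k c : continuousType R N := mkcts (@cst_continuous R N c).
have kE c s t : cls (arc_chain (k c) s t) = 0 by exact: cls_arc_cst.
have := @cls_homotopy _ _ G K0 K (k (K0 a)) (k (K0 b)) a (next_after a b) cG.
rewrite !kE addr0 subr0; apply => //.
- by move=> t; rewrite G0.
- by move=> t; rewrite G1.
- by move=> r r01; rewrite nE (periodicz (fun t => Gper t r01)) Gb.
Qed.

(** If the gap reached 1, it would be equal to 1 at some positive time, when the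
    two branches would meet although the curve is a knot. *)
Lemma moves_above_gap a b (alpha beta : R -> R) :
  (forall r, 0 < r <= 1 -> knot (G r)) -> ~ same_mod1 a b ->
  pi (K0 a) = pi (K0 b) ->
  {within `[0, 1], continuous alpha} -> {within `[0, 1], continuous beta} ->
  alpha 0 = beta 0 ->
  (forall r, 0 <= r <= 1 -> G r a = fiber pi (pi (K0 a)) (alpha r) /\
                                 G r b = fiber pi (pi (K0 b)) (beta r)) ->
  alpha 1 < beta 1 + 1.
Proof.
move=> kG nab piab ca cb ab0 Gab; rewrite ltNge; apply/negP => gap.
have cf : {within `[0, 1], continuous (alpha \- beta)}.
  by move=> x; apply: continuousB; [exact: ca | exact: cb].
have [|r] := @IVT R (alpha \- beta) 0 1 1 ler01 cf.
  by rewrite /= ab0 subrr ge_min ler01 /= le_max; apply/orP; right; lra.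
rewrite in_itv /= => r01 rE.
have r_gt0 : 0 < r.
  rewrite lt_neqAle; case/andP: (r01) => -> _; rewrite andbT; apply/eqP => r0.
  by move: rE; rewrite -r0 ab0 subrr => /eqP; rewrite eq_sym oner_eq0.
have [Ga Gb] := Gab r r01.
have rI : 0 < r <= 1 by rewrite r_gt0; case/andP: r01.
have [_ /(_ a b) sep _ _] := kG r rI.
case: sep => [|//|[d]]; last by rewrite in_nil.
have rE' : alpha r = beta r + 1 by rewrite -rE addrC subrK.
apply: etrans Ga (etrans _ (esym Gb)); rewrite -piab rE'; exact: fiber_periodic.
Qed.

(** The branch at a is the upper one.  The closing arc of fiber goes from beta 1
    up to alpha 1 in the first case, and from alpha 1 up to beta 1 + 1 in the
    second: both have length less than 1, by [moves_above_gap]. *)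
Lemma closed_arc_crossing a b :
  (forall r, 0 < r <= 1 -> knot (G r)) -> ~ same_mod1 a b ->
  K0 a = K0 b -> moves_above pi G a b ->
  closed_arc_class pi K a b = loop_class K0 a b /\
  closed_arc_class pi K b a = loop_class K0 b a + fiber_class pi (pi (K0 a)).
Proof.
move=> kG nab K0ab [alpha [beta [ca cb ab0]]]; rewrite G0 => Gab lt_ba.
have piab : pi (K0 a) = pi (K0 b) by rewrite K0ab.
have gap := moves_above_gap kG nab piab ca cb ab0 Gab.
have r1 : 0 < (1 : R) <= 1 by rewrite ltr01 lexx.
have lt1 := lt_ba 1 r1.
have Ga r : 0 <= r <= 1 -> G r a = fiber pi (pi (K0 a)) (alpha r) by move=> /Gab[].
have Gb r : 0 <= r <= 1 -> G r b = fiber pi (pi (K0 a)) (beta r) by rewrite piab => /Gab[].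
split.
  rewrite (closed_arc_resolved (n := 0) cG G0 G1 Gper ca cb ab0 Ga Gb) ?addr0 //.
  by rewrite ltW // gap.
rewrite piab in Ga Gb *.
rewrite (closed_arc_resolved (n := 1) cG G0 G1 Gper cb ca (esym ab0) Gb Ga) ?mulr1n //.
by lra.
Qed.
End Motion.
End Crossings.

Definition congruent_pair (R : realType) (st d : R * R) : Prop :=
  (same_mod1 st.1 d.1 /\ same_mod1 st.2 d.2) \/
  (same_mod1 st.1 d.2 /\ same_mod1 st.2 d.1).

Section Resolutions.
Context {R : realType} {N : oriented_manifold R 3} {F : oriented_manifold R 2}.
Variable pi : circle_fibration N F.
Implicit Types (K : continuousType R N) (D : seq (R * R)) (s t : R).

Definition crossing_term K (st : R * R) : gring (H1 R N) :=
  << mu_plus pi K st >> - << mu_minus pi K st >>.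

(** With the convention that the pair of parameters is a positive frame: the
    branch at st.1 is the upper one in the positive resolution, and the arc
    leading from st.2 to st.1 then contributes a full turn of the fiber. *)
Definition resolved_term (K0 : continuousType R N) (f : H1 R N) (st : R * R) (sg : bool) :
  gring (H1 R N) :=
  << loop_class K0 st.2 st.1 + f *+ sg >> - << loop_class K0 st.1 st.2 + f *+ ~~ sg >>.

Section One.
Variables (K0 : continuousType R N) (D : seq (R * R)) (sgs : seq bool) (K : continuousType R N).
Hypothesis K0D : singular_knot K0 D.
Hypothesis K0gen : generic_loop (pi \o K0).
Hypothesis res : resolution pi K0 D sgs K.

Let K01 : forall t, K0 (t + 1) = K0 t.
Proof. by case: K0D => [[]]. Qed.

Let eta1 : forall t, (pi \o K0) (t + 1) = (pi \o K0) t.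
Proof. by move=> t; rewrite /= K01. Qed.

Let seta : smooth_curve (pi \o K0).
Proof. by case: K0gen => [[]]. Qed.

Lemma motion_periodic (G : R -> continuousType R N) : G 0 = K0 ->
  (forall r, 0 < r <= 1 -> knot (G r)) ->
  forall r t, 0 <= r <= 1 -> G r (t + 1) = G r t.
Proof.
move=> G0 kG r t /andP[r0 r1]; move: r0; rewrite le_eqVlt => /orP[/eqP <-|r0].
  by rewrite G0 K01.
have rI : 0 < r <= 1 by rewrite r0.
by case: (kG r rI) => [[]].
Qed.

Lemma resolution_knot_class : knot_class K = knot_class K0.
Proof.
have [G [cG [G0 G1] kG _ _]] := res.
exact: knot_class_motion cG G0 G1 (motion_periodic G0 kG).
Qed.

Lemma resolution_double_points : double_points pi K = double_points pi K0.
Proof.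
have [G [_ [G0 G1] _ GK _]] := res.
have r1 : 0 <= (1 : R) <= 1 by rewrite lexx ler01.
have E : pi \o K = pi \o K0.
  by apply/funext => s /=; rewrite -G1; case: (GK 1 s r1).
have E' s : pi (K s) = pi (K0 s) by have := congr1 (fun f => f s) E.
by apply/seteqP; split => -[s t]; rewrite /double_points /= E !E'.
Qed.

Lemma crossing_term_fixed s t : pi (K0 s) = pi (K0 t) -> K0 s <> K0 t ->
  crossing_term K (s, t) = crossing_term K0 (s, t).
Proof.
move=> est nst; have [G [cG [G0 G1] kG GK _]] := res.
have per := motion_periodic G0 kG.
have Gs r : 0 <= r <= 1 -> G r s = K0 s.
  by move=> r01; case: (GK r s r01) => _; apply; exists t.
have Gt r : 0 <= r <= 1 -> G r t = K0 t.
  by move=> r01; case: (GK r t r01) => _; apply; exists s; split => // /esym.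
rewrite /crossing_term /mu_plus /mu_minus /=.
by rewrite !(closed_arc_fixed cG G0 G1 per).
Qed.

(** As a frame and its reverse are not both positive, the sign of the resolution
    tells which of the two branches is raised. *)
Lemma crossing_term_resolved a b sg s t : ((a, b), sg) \in zip D sgs ->
  (s = a /\ t = b) \/ (s = b /\ t = a) -> positive_frame (pi \o K0) s t ->
  crossing_term K (s, t) = resolved_term K0 (fiber_class pi (pi (K0 s))) (s, t) sg.
Proof.
move=> dsg st pf; have [G [cG [G0 G1] kG GK [szD sgnG]]] := res.
have per := motion_periodic G0 kG.
have dD : (a, b) \in D.
  have := map_f fst dsg; rewrite -/(unzip1 _) unzip1_zip //.
  by rewrite szD.
have [_ _ /(_ _ dD)[/= Kab nab _] _] := K0D.
have eab : (pi \o K0) a = (pi \o K0) b by rewrite /= Kab.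
have excl := positive_frame_excl seta eab.
have excl' := positive_frame_excl seta (esym eab).
have Kst : K0 s = K0 t by case: st => -[-> ->].
have nst : ~ same_mod1 s t.
  case: st => -[-> ->] //; rewrite /same_mod1 -rpredN opprB; exact: nab.
have mv : resolves_with_sign pi G a b sg ->
    if sg then moves_above pi G s t else moves_above pi G t s.
  rewrite /resolves_with_sign G0.
  case: st pf => -[-> ->] pf; case: (sg) => /= -[[mv pf']|[mv pf']].
  - exact: mv.
  - by case: (excl pf pf').
  - by case: (excl pf pf').
  - exact: mv.
  - by case: (excl pf' pf).
  - exact: mv.
  - exact: mv.
  - by case: (excl pf' pf).
have {}mv := mv (sgnG _ _ dsg).
rewrite /crossing_term /resolved_term /mu_plus /mu_minus /=.
case: (sg) mv => mv.
  have [-> ->] := closed_arc_crossing cG G0 G1 per kG nst Kst mv.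
  by rewrite mulr1n mulr0n addr0.
have nts : ~ same_mod1 t s by rewrite /same_mod1 -rpredN opprB.
have [-> ->] := closed_arc_crossing cG G0 G1 per kG nts (esym Kst) mv.
by rewrite Kst mulr1n mulr0n addr0.
Qed.

(** Singular points are listed by arbitrary parameters and in any order, double
    points by parameters in [0, 1) ordered by the frame. *)
Lemma crossing_term_at st d sg : double_points pi K0 st -> (d, sg) \in zip D sgs ->
  congruent_pair st d ->
  crossing_term K st = resolved_term K0 (fiber_class pi (pi (K0 st.1))) st sg.
Proof.
case: st d => s t [a b] [/= _ _ _ est pf] dsg std.
have [G [cG [G0 G1] kG GK _]] := res.
have r1 : 0 <= (1 : R) <= 1 by rewrite lexx ler01.
have K1 u : K (u + 1) = K u by rewrite -G1 (motion_periodic G0 kG).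
suff gen (a' b' : R) (m n : int) : (a' = a /\ b' = b) \/ (a' = b /\ b' = a) ->
    positive_frame (pi \o K0) (a' + m%:~R) (b' + n%:~R) ->
    crossing_term K (a' + m%:~R, b' + n%:~R) =
    resolved_term K0 (fiber_class pi (pi (K0 (a' + m%:~R)))) (a' + m%:~R, b' + n%:~R) sg.
  by case: std pf => -[/same_mod1P[m /= ->] /same_mod1P[n /= ->]]; apply: gen; [left|right].
move=> ab' pf'.
have pf0 : positive_frame (pi \o K0) a' b'.
  have := positive_frame_periodic (- n) eta1 (periodicz eta1 (- m) (a' + m%:~R)) pf'.
  by rewrite !mulrNz !addrK.
have := crossing_term_resolved dsg ab' pf0.
rewrite /crossing_term /resolved_term /mu_plus /mu_minus /=.
rewrite (closed_arc_shift pi b' a' n m K1) (closed_arc_shift pi a' b' m n K1).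
rewrite (loop_class_shift b' a' n m K01) (loop_class_shift a' b' m n K01).
by rewrite (periodicz K01 m a').
Qed.

Lemma crossing_cases st : double_points pi K0 st -> K0 st.1 <> K0 st.2 \/
  exists2 d, d \in D & congruent_pair st d.
Proof.
move=> [s01 t01 /eqP nst _ _]; have [Kst|] := pselect (K0 st.1 = K0 st.2); last by left.
right; have [_ /(_ _ _ Kst)[/same_mod1_eq eq|//] _ _] := K0D.
by case: nst; apply: eq; move: s01 t01; lra.
Qed.

(** This uses the finiteness of the support: the sum in S_K is 0 by convention
    when it is infinite. *)
Lemma S_knot_sum (k f : H1 R N) : S_knot pi k f K =
  \sum_(st <- fset_set (double_points pi K0)) Hproj k f (crossing_term K st).
Proof.
by rewrite /S_knot resolution_double_points fsbig_finite //; exact: double_points_finite.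
Qed.
End One.
End Resolutions.

(** * Comparison of the sums over the double points *)

Section Assembling.
Context {R : realType} {N : oriented_manifold R 3} {F : oriented_manifold R 2}.
Variable pi : circle_fibration N F.
Implicit Types (K : continuousType R N) (D : seq (R * R)) (s t : R).

(** The loops cover one period of K, split at the time congruent to b. *)
Lemma knot_class_split K a b : (forall t, K (t + 1) = K t) -> K a = K b ->
  ~ same_mod1 a b -> loop_class K a b + loop_class K b a = knot_class K.
Proof.
move=> K1 Kab nab; have [n E abI] := next_afterP a b.
(* The bounds on next_after b a are strict where those on next_after a b are
   not; a and b are not congruent. *)
have neq : a != b + n%:~R by apply/eqP => h; apply: nab; apply/same_mod1P; exists n.
have E' : next_after b a = a + (1 - n)%:~R.
  apply: next_after_uniq; rewrite intrB; move: abI neq; rewrite E neq_lt; lra.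
rewrite /loop_class /knot_class E E' -(arc_shift K1 n b).
have -> : a + (1 - n)%:~R + n%:~R = a + 1 by rewrite intrB; lra.
have Kbn : K (b + n%:~R) = K b by exact: periodicz.
rewrite -hclassD.
- apply: hclass_cls.
  + by apply: is_cycleD; apply: is_cycle_loop; rewrite Kbn ?K1.
  + by apply: is_cycle_loop; rewrite -[in RHS](add0r 1) K1.
  + by rewrite raddfD /= cls_arcD (cls_loop K1).
- by apply: is_cycle_loop; rewrite Kbn.
- by apply: is_cycle_loop; rewrite Kbn K1.
Qed.

Section Crossing.
Variables (K : continuousType R N) (D : seq (R * R)) (a b : R).
Hypothesis KD : singular_knot K D.
Hypothesis Kgen : generic_loop (pi \o K).
Hypothesis dD : (a, b) \in D.

Let K1 : forall t, K (t + 1) = K t.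
Proof. by case: KD => [[]]. Qed.

Let eta1 : forall t, (pi \o K) (t + 1) = (pi \o K) t.
Proof. by move=> t; rewrite /= K1. Qed.

Let seta : smooth_curve (pi \o K).
Proof. by case: Kgen => [[]]. Qed.

Let Kab : K a = K b.
Proof. by have [_ _ /(_ _ dD)[]] := KD. Qed.

Let nab : ~ same_mod1 a b.
Proof. by have [_ _ /(_ _ dD)[]] := KD. Qed.

(** The branches are transverse, so one of the two orders is a positive frame. *)
Lemma crossing_exists : exists2 st, double_points pi K st & congruent_pair st (a, b).
Proof.
have eab : (pi \o K) a = (pi \o K) b by rewrite /= Kab.
have tr : transverse_at (pi \o K) a b by case: Kgen => _ /(_ a b nab eab).
have red s : exists n : int, 0 <= s + n%:~R < 1.
  have [n E] := next_afterP 0 s; rewrite add0r => h; exists n; rewrite -E; exact: h.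
suff gen s t : K s = K t -> ~ same_mod1 s t -> positive_frame (pi \o K) s t ->
    exists2 st, double_points pi K st & same_mod1 st.1 s /\ same_mod1 st.2 t.
  have [pf|pf] := transverse_frame eab tr.
    by have [st dst sts] := gen a b Kab nab pf; exists st => //; left.
  have nba : ~ same_mod1 b a by move=> /same_mod1C.
  by have [st dst sts] := gen b a (esym Kab) nba pf; exists st => //; right.
move=> Kst nst pf; have [m mI] := red s; have [n nI] := red t.
exists (s + m%:~R, t + n%:~R); last by split; apply/same_mod1P; [exists m|exists n].
split; [exact: mI | exact: nI | | |].
- apply/eqP => h; apply: nst; apply/same_mod1P; exists (n - m).
  by rewrite intrB addrA -[t + _]h addrK.
- by rewrite /= !(periodicz K1) Kst.
- exact: (positive_frame_periodic n eta1 (periodicz eta1 m s) pf).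
Qed.

Lemma crossing_unique st st' : double_points pi K st -> double_points pi K st' ->
  congruent_pair st (a, b) -> congruent_pair st' (a, b) -> st = st'.
Proof.
have pf0 st0 s t : double_points pi K st0 -> same_mod1 st0.1 s -> same_mod1 st0.2 t ->
    positive_frame (pi \o K) s t.
  move=> [_ _ _ _ pf] /same_mod1C/same_mod1P[m ->] /same_mod1C/same_mod1P[n ->].
  exact: (positive_frame_periodic n eta1 (periodicz eta1 m st0.1) pf).
have eab : (pi \o K) a = (pi \o K) b by rewrite /= Kab.
have excl := positive_frame_excl seta eab.
have eqst s t : double_points pi K st -> double_points pi K st' ->
    same_mod1 st.1 s -> same_mod1 st.2 t -> same_mod1 st'.1 s -> same_mod1 st'.2 t ->
    st = st'.
  case: st st' => s1 t1 [s2 t2] /= [/= s1I t1I _ _ _] [/= s2I t2I _ _ _] s1s t1t s2s t2t.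
  congr (_, _); apply: same_mod1_eq.
  - exact: same_mod1_trans s1s (same_mod1C s2s).
  - by move: s1I s2I; lra.
  - exact: same_mod1_trans t1t (same_mod1C t2t).
  - by move: t1I t2I; lra.
move=> dst dst' [[h1 h2]|[h1 h2]] [[h1' h2']|[h1' h2']].
- exact: eqst h1 h2 h1' h2'.
- by case: (excl (pf0 _ _ _ dst h1 h2) (pf0 _ _ _ dst' h1' h2')).
- by case: (excl (pf0 _ _ _ dst' h1' h2') (pf0 _ _ _ dst h1 h2)).
- exact: eqst h1 h2 h1' h2'.
Qed.
End Crossing.

Lemma gmul_expand (A : zmodType) (f x y : A) :
  gmul (<< f >> - << 0 >>) (<< x >> + << y >>) =
  (<< x + f >> - << y >>) - (<< x >> - << y + f >>).
Proof.
have liftD (h : A -> gring A) u v : fglift h (u + v) = fglift h u + fglift h v.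
  have lift0 : fglift h 0 = 0 by rewrite -[X in fglift h X](subrr (0 : gring A)) lift_is_additive subrr.
  have liftN w : fglift h (- w) = - fglift h w by rewrite -sub0r lift_is_additive lift0 sub0r.
  by rewrite -[v]opprK lift_is_additive -liftN.
rewrite /gmul lift_is_additive !liftU !scale1r !liftD !liftU !scale1r !add0r.
rewrite [f + x]addrC [f + y]addrC opprD opprB -!addrA; congr (_ + _).
by rewrite [RHS]addrC -addrA.
Qed.

Lemma HprojB (A : zmodType) (k f : A) u v : Hproj k f (u - v) = Hproj k f u - Hproj k f v.
Proof. by rewrite /Hproj raddfB. Qed.
End Assembling.

Theorem mainTheorem8 (R : realType) (N : oriented_manifold R 3)
    (F : oriented_manifold R 2) (pi : circle_fibration N F) (x0 : F) :
  let f := fiber_class pi x0 in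
  (forall (K' Kp Km : continuousType R N) (a b : R),
     singular_knot K' [:: (a, b)] ->
     generic_loop (pi \o K') ->
     connected_component [set: F] (pi (K' 0)) x0 ->
     resolution pi K' [:: (a, b)] [:: true] Kp ->
     resolution pi K' [:: (a, b)] [:: false] Km ->
     let xi1 := loop_class K' a b in
     let xi2 := loop_class K' b a in
     let k := xi1 + xi2 in
     [/\ knot_class Kp = k, knot_class Km = k &
         S_knot pi k f Kp - S_knot pi k f Km =
         Hproj k f (gmul (<< f >> - << 0 >>) (<< xi1 >> + << xi2 >>))]) /\
  (forall (K' Kpp Kpm Kmp Kmm : continuousType R N) (a1 b1 a2 b2 : R),
     let D := [:: (a1, b1); (a2, b2)] in
     singular_knot K' D ->
     generic_loop (pi \o K') ->
     connected_component [set: F] (pi (K' 0)) x0 ->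
     resolution pi K' D [:: true; true] Kpp ->
     resolution pi K' D [:: true; false] Kpm ->
     resolution pi K' D [:: false; true] Kmp ->
     resolution pi K' D [:: false; false] Kmm ->
     let k := knot_class K' in
     [/\ knot_class Kpp = k, knot_class Kpm = k, knot_class Kmp = k,
         knot_class Kmm = k &
         S_knot pi k f Kpp - S_knot pi k f Kpm - S_knot pi k f Kmp + S_knot pi k f Kmm = 0]).
Proof.
move=> f.
have fE (K : continuousType R N) s : continuous (pi \o K) ->
    connected_component [set: F] (pi (K 0)) x0 -> fiber_class pi (pi (K s)) = f.
  move=> cK conn; rewrite /f -(fiber_class_component pi conn).
  exact: (fiber_class_curve pi s 0 cK).
split=> [K' Kp Km a b KD Kgen conn resp resm xi1 xi2 k|
         K' Kpp Kpm Kmp Kmm a1 b1 a2 b2 D KD Kgen conn rpp rpm rmp rmm k].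
- have K1 t : K' (t + 1) = K' t by case: KD => [[]].
  have ceta : continuous (pi \o K') by case: Kgen => [[[]]].
  have dD : (a, b) \in [:: (a, b)] by rewrite inE.
  have [_ _ /(_ _ dD)[/= Kab nab _] _] := KD.
  have kE : knot_class K' = k by rewrite -(knot_class_split K1 Kab nab).
  split; [by rewrite (resolution_knot_class KD resp) | by rewrite (resolution_knot_class KD resm) |].
  rewrite (S_knot_sum Kgen resp) (S_knot_sum Kgen resm) -sumrB.
  have [v dv vab] := crossing_exists KD Kgen dD.
  have fA := double_points_finite Kgen.
  have vA : v \in fset_set (double_points pi K') by rewrite in_fset_set // inE.
  rewrite (bigD1_seq v vA (fset_uniq _)) [X in _ + X = _]big1_seq ?addr0; last first.
    move=> w /andP[wv]; rewrite in_fset_set // inE => dw.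
    have [nKw|[d]] := crossing_cases KD dw.
      case: w {wv} dw nKw => s t [/= _ _ _ est _] nKw.
      by rewrite (crossing_term_fixed KD resp est nKw) (crossing_term_fixed KD resm est nKw) subrr.
    rewrite inE => /eqP -> wab; case/eqP: wv.
    exact: (crossing_unique KD Kgen dD dw dv wab vab).
  rewrite -HprojB; congr (Hproj k f _).
  have zp : ((a, b), true) \in zip [:: (a, b)] [:: true] by rewrite inE.
  have zm : ((a, b), false) \in zip [:: (a, b)] [:: false] by rewrite inE.
  rewrite (crossing_term_at KD Kgen resp dv zp vab) (crossing_term_at KD Kgen resm dv zm vab).
  rewrite fE // /resolved_term !mulr1n !mulr0n !addr0.
  case: v vab {dv vA} => s t [[/same_mod1P[m /= ->] /same_mod1P[n /= ->]]|
                       [/same_mod1P[m /= ->] /same_mod1P[n /= ->]]].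
    rewrite !(loop_class_shift _ _ _ _ K1) -/xi1 -/xi2 [<< xi1 >> + _]addrC.
    exact/esym/gmul_expand.
  rewrite !(loop_class_shift _ _ _ _ K1) -/xi1 -/xi2.
  exact/esym/gmul_expand.
- have ceta : continuous (pi \o K') by case: Kgen => [[[]]].
  split; try by [exact: (resolution_knot_class KD rpp) | exact: (resolution_knot_class KD rpm) |
    exact: (resolution_knot_class KD rmp) | exact: (resolution_knot_class KD rmm)].
  rewrite (S_knot_sum Kgen rpp) (S_knot_sum Kgen rpm) (S_knot_sum Kgen rmp) (S_knot_sum Kgen rmm).
  rewrite -!sumrB -big_split /= big1_seq // => w /andP[_].
  rewrite in_fset_set ?inE; last exact: double_points_finite.
  move=> dw; have [nKw|[d]] := crossing_cases KD dw.
    case: w dw nKw => s t [/= _ _ _ est _] nKw.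
    rewrite (crossing_term_fixed KD rpp est nKw) (crossing_term_fixed KD rpm est nKw).
    rewrite (crossing_term_fixed KD rmp est nKw) (crossing_term_fixed KD rmm est nKw).
    by rewrite subrr sub0r addNr.
  have z (sg1 sg2 : bool) : ((a1, b1), sg1) \in zip D [:: sg1; sg2] by rewrite !inE eqxx.
  have z' (sg1 sg2 : bool) : ((a2, b2), sg2) \in zip D [:: sg1; sg2] by rewrite !inE eqxx orbT.
  rewrite !inE => /orP[] /eqP -> wd.
    rewrite (crossing_term_at KD Kgen rpp dw (z _ _) wd) (crossing_term_at KD Kgen rpm dw (z _ _) wd).
    rewrite (crossing_term_at KD Kgen rmp dw (z _ _) wd) (crossing_term_at KD Kgen rmm dw (z _ _) wd).
    by rewrite subrr sub0r addNr.
  rewrite (crossing_term_at KD Kgen rpp dw (z' _ _) wd) (crossing_term_at KD Kgen rpm dw (z' _ _) wd).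
  rewrite (crossing_term_at KD Kgen rmp dw (z' _ _) wd) (crossing_term_at KD Kgen rmm dw (z' _ _) wd).
  by rewrite addrAC subrK subrr.
Qed.
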